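(* Let $m\ge2$ and let $q$ be a real number with $0\le q<2^{m-1}$. Then the following assertion is false: ''For every $\Delta>1$ and every tuple $(p_j)_{j\in\mathcal{C}}$ with $q<p_j\le\infty$ for all $j\in\mathcal{C}$ and $\sum_{j\in\mathcal{C}}\frac1{p_j}=1$, there is a constant $C$ such that for every real $m\times2m$ matrix $\Pi$ for which $\Pi_j\Pi^T$ is $\Delta$-regular for each $j\in\mathcal{C}$, for all Calderón-Zygmund kernels $K$ in $\mathbb{R}^m$ of order $2^{6m}$, and for all tuples $(F_j)_{j\in\mathcal{C}}$ of real-valued smooth compactly supported functions on $\mathbb{R}^m$, one has $$\Big|\mathrm{p.v.}\int_{\mathbb{R}^{2m}}\prod_{j\in\mathcal{C}}F_j(\Pi_jx)\,K(\Pi x)\,dx\Big|\le C\prod_{j\in\mathcal{C}}\|F_j\|_{p_j}.''$$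
   Context: $\mathcal{C}$ is the set of all functions $j:\{1,\dots,m\}\to\{0,1\}$. Vectors in $\mathbb{R}^{2m}$ are written $x=(x_1^0,\dots,x_m^0,x_1^1,\dots,x_m^1)^T$. For $j\in\mathcal{C}$, $\Pi_j:\mathbb{R}^{2m}\to\mathbb{R}^m$ is the projection $\Pi_jx=(x_1^{j(1)},\dots,x_m^{j(m)})^T$, also regarded as an $m\times 2m$ matrix. An $m\times m$ matrix $A$ is $\Delta$-regular if $\max(|A|,|\det A|^{-1})\le\Delta$, where $|A|$ is the operator norm. A Calderón-Zygmund kernel $K$ of order (degree) $n$ in $\mathbb{R}^m$ is the (distributional) Fourier transform of integration against a function $\widehat K$ on $\mathbb{R}^m\setminus\{0\}$ satisfying $|\partial^\beta\widehat K(\eta)|\le|\eta|^{-|\beta|}$ for all $\eta\neq0$ and all multi-indices $\beta$ of order $|\beta|\le n$. The principal value integral denotes the pairing of the Schwartz function $\phi=\prod_{j\in\mathcal{C}}F_j\circ\Pi_j$ with the tempered distribution $K\circ\Pi$, which is $$\mathrm{p.v.}\int_{\mathbb{R}^{2m}}\phi(x)K(\Pi x)\,dx=\int_{\mathbb{R}^m}\widehat\phi(-\Pi^T\eta)\,\widehat K(\eta)\,d\eta,$$ with $\widehat\phi(\xi)=\int\phi(x)e^{-2\pi i x^T\xi}\,dx$. *)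

(* Defs.v *)
From HB Require Import structures.
From mathcomp Require Import all_boot all_order all_algebra.
From mathcomp Require Import complex.
From mathcomp Require Import all_classical all_reals all_analysis.

Set Implicit Arguments.
Unset Strict Implicit.
Unset Printing Implicit Defensive.

Import Order.TTheory GRing.Theory Num.Theory.
Import numFieldNormedType.Exports.

Local Open Scope classical_set_scope.
Local Open Scope ring_scope.

(* Borel sets of R^n: the sigma-algebra generated by the coordinate maps,
   like the library's one on tuples. *)
Section measurable_cV.
Context {R : realType} (n : nat).

Definition coord_cV (i : 'I_n) (v : 'cV[R]_n) : R := v i ord0.

Let cV_set0 : g_sigma_preimage coord_cV set0.
Proof. exact: sigma_algebra0. Qed.

Let cV_setC A : g_sigma_preimage coord_cV A -> g_sigma_preimage coord_cV (~` A).
Proof. exact: sigma_algebraC. Qed.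

Let cV_bigcup (F : (set _)^nat) : (forall i, g_sigma_preimage coord_cV (F i)) ->
  g_sigma_preimage coord_cV (\bigcup_i (F i)).
Proof. exact: sigma_algebra_bigcup. Qed.

HB.instance Definition _ := @isMeasurable.Build default_measure_display
  'cV[R]_n (g_sigma_preimage coord_cV) cV_set0 cV_setC cV_bigcup.

End measurable_cV.

Section cons_cV.
Context {R : realType}.

Definition cons_cV n (xv : R * 'cV[R]_n) : 'cV[R]_n.+1 :=
  \col_i (if unlift ord0 i is Some k then xv.2 k ord0 else xv.1).

Definition uncons_cV n (v : 'cV[R]_n.+1) : R * 'cV[R]_n :=
  (v ord0 ord0, \col_k v (lift ord0 k) ord0).

Lemma cons_cVK n : cancel (@cons_cV n) (@uncons_cV n).
Proof.
case=> x v; congr pair; first by rewrite mxE unlift_none.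
by apply/matrixP => i j; rewrite !mxE liftK (ord1 j).
Qed.

Lemma measurable_coord_cV n (i : 'I_n) : measurable_fun setT (@coord_cV R n i).
Proof.
move=> _ A mA; rewrite setTI; apply: sub_sigma_algebra.
case: n i => [[] []//|n i].
rewrite -bigcup_mkord_ord; exists i => //=.
by exists A => //; rewrite setTI/= inord_val.
Qed.

Lemma measurable_to_cV d (T : measurableType d) n (f : T -> 'cV[R]_n) :
  (forall i, measurable_fun setT (fun x => f x i ord0)) -> measurable_fun setT f.
Proof.
move=> mf _ A; rewrite setTI.
suff: g_sigma_preimage (@coord_cV R n) `<=` [set A | measurable (f @^-1` A)].
  exact.
apply: smallest_sub.
  split => /=; first by rewrite preimage_set0.
  - by move=> B mB; rewrite setTD preimage_setC; exact: measurableC.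
  - by move=> F mF; rewrite preimage_bigcup; exact: bigcupT_measurable.
case: n {A} f mf => [|n] f mf B; first by rewrite big_ord0.
rewrite -bigcup_mkord_ord => -[i _ [C mC <-]] /=.
have := mf (inord i) measurableT C mC.
by rewrite !setTI.
Qed.

Lemma measurable_cons_cV n : measurable_fun setT (@cons_cV n).
Proof.
apply: measurable_to_cV => i; case: (unliftP ord0 i) => [k ->|->].
  under eq_fun do rewrite mxE liftK.
  exact: (measurableT_comp (measurable_coord_cV k) measurable_snd).
by under eq_fun do rewrite mxE unlift_none; exact: measurable_fst.
Qed.

Lemma measurable_uncons_cV n : measurable_fun setT (@uncons_cV n).
Proof.
apply/measurable_fun_pairP; split.
  exact: (measurable_coord_cV ord0).
apply: measurable_to_cV => k /=.
under eq_fun do rewrite mxE.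
exact: (measurable_coord_cV (lift ord0 k)).
Qed.

End cons_cV.

(* The image of (Lebesgue measure on R) x mu under R x R^n ~ R^(n+1). *)
Section lebesgue_cV_succ.
Context {R : realType} (n : nat) (mu : {sigma_finite_measure set 'cV[R]_n -> \bar R}).

Definition lebesgue_cV_succ : set 'cV[R]_n.+1 -> \bar R :=
  pushforward (lebesgue_measure \x mu)%E (@cons_cV R n).

Let lebesgue_cV_succ0 : lebesgue_cV_succ set0 = 0%E.
Proof. by rewrite /lebesgue_cV_succ /pushforward preimage_set0 measure0. Qed.

Let lebesgue_cV_succ_ge0 A : (0 <= lebesgue_cV_succ A)%E.
Proof. by apply: integral_ge0 => x _; exact: measure_ge0. Qed.

Let preim_cons A : measurable A -> measurable (@cons_cV R n @^-1` A).
Proof.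
by move=> mA; rewrite -[X in measurable X]setTI; exact: measurable_cons_cV.
Qed.

Let lebesgue_cV_succ_sigma_additive : semi_sigma_additive lebesgue_cV_succ.
Proof.
move=> F mF tF mUF; rewrite /lebesgue_cV_succ /pushforward preimage_bigcup.
apply: measure_semi_sigma_additive.
- by move=> k; exact: preim_cons.
- apply/trivIsetP => /= i j _ _ ij; rewrite -preimage_setI.
  by move/trivIsetP : tF => /(_ _ _ _ _ ij) ->//; rewrite preimage_set0.
- by rewrite -preimage_bigcup; exact: preim_cons.
Qed.

HB.instance Definition _ := isMeasure.Build _ _ _ lebesgue_cV_succ
  lebesgue_cV_succ0 lebesgue_cV_succ_ge0 lebesgue_cV_succ_sigma_additive.

Let lebesgue_cV_succ_sigma_finite : sigma_finite setT lebesgue_cV_succ.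
Proof.
have /sigma_finiteP[F [TF ndF Foo]] :=
  sigma_finiteT (@lebesgue_measure R : {sigma_finite_measure set _ -> \bar R}).
have /sigma_finiteP[G [TG ndG Goo]] := sigma_finiteT mu.
exists (fun k => @uncons_cV R n @^-1` (F k `*` G k)).
  rewrite -preimage_bigcup (_ : \bigcup_k _ = setT) ?preimage_setT//.
  apply/seteqP; split=> // -[x y] _.
  have [k _ Fkx] : (\bigcup_k F k) x by rewrite -TF.
  have [l _ Gly] : (\bigcup_k G k) y by rewrite -TG.
  exists (maxn k l) => //; split => /=.
  - by move: x Fkx; exact/subsetPset/ndF/leq_maxl.
  - by move: y Gly; exact/subsetPset/ndG/leq_maxr.
move=> k; have [mF Fk] := Foo k; have [mG Gk] := Goo k; split.
  rewrite -[X in measurable X]setTI; apply: measurable_uncons_cV => //.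
  exact: measurableX.
rewrite /lebesgue_cV_succ /pushforward -comp_preimage.
rewrite (_ : _ \o _ = id); last by apply/funext => xv /=; rewrite cons_cVK.
by rewrite preimage_id product_measure1E// lte_mul_pinfty// ge0_fin_numE.
Qed.

HB.instance Definition _ := Measure_isSigmaFinite.Build _ _ _
  lebesgue_cV_succ lebesgue_cV_succ_sigma_finite.

End lebesgue_cV_succ.

Fixpoint lebesgue_cV {R : realType} (n : nat) :
    {sigma_finite_measure set 'cV[R]_n -> \bar R} :=
  if n is k.+1 then lebesgue_cV_succ (lebesgue_cV k) else dirac (0 : 'cV[R]_0).

Lemma lebesgue_cV_box (R : realType) n (A : 'I_n -> set R) :
  (forall i, measurable (A i)) ->
  lebesgue_cV n [set v | forall i, A i (v i ord0)] =
  (\prod_(i < n) lebesgue_measure (A i))%E.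
Proof.
elim: n A => [|n IH] A mA.
  by rewrite big_ord0 /= diracE mem_set// => -[].
rewrite big_ord_recl /= -IH => [|i]; last exact: mA.
have mB : measurable [set v : 'cV[R]_n | forall i, A (lift ord0 i) (v i ord0)].
  rewrite (_ : [set v | _] =
    \bigcap_(i in [set: 'I_n]) (@coord_cV R n i @^-1` A (lift ord0 i))).
    apply: fin_bigcap_measurable => // i _.
    by rewrite -[X in measurable X]setTI; exact: measurable_coord_cV.
  by apply/seteqP; split=> v /= Av => [i _|i]; [exact: Av|exact: (Av i I)].
rewrite -product_measure1E; [|exact: mA|exact: mB].
rewrite /lebesgue_cV_succ /pushforward; congr product_measure1.
apply/seteqP; split => -[x v] /=.
  move=> Axv; split; first by have := Axv ord0; rewrite mxE unlift_none.
  by move=> i; have := Axv (lift ord0 i); rewrite mxE liftK.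
move=> [Ax Av] i; rewrite mxE; case: (unliftP ord0 i) => [k ->|->] /=.
  exact: Av.
exact: Ax.
Qed.

(* The library's norm `|v| on matrices is the sup norm. *)
Definition enorm (R : realType) n (v : 'cV[R]_n) : R :=
  Num.sqrt (\sum_i v i ord0 ^+ 2).

Definition opnorm (R : realType) n (A : 'M[R]_n) : R :=
  sup [set enorm (A *m v) | v in [set v : 'cV[R]_n | enorm v <= 1]].

(* |det A|^-1 is infinite for singular A, whereas 0^-1 = 0 in the library. *)
Definition Delta_regular (R : realType) n (Delta : R) (A : 'M[R]_n) : Prop :=
  \det A != 0 /\ Num.max (opnorm A) `|\det A|^-1 <= Delta.

(* 'I_m is 0-based; false and true stand for the superscripts 0 and 1. *)
Definition cube (m : nat) := {ffun 'I_m -> bool}.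

(* x_i^0 and x_i^1 are the coordinates lshift m i and rshift m i of x. *)
Definition coord_proj (R : realType) m (j : cube m) : 'M[R]_(m, m + m) :=
  \matrix_(i, k) (k == if j i then rshift m i else lshift m i)%:R.

Definition partial (R : realType) n (i : 'I_n) (f : 'cV[R]_n -> R) :
    'cV[R]_n -> R :=
  fun x => 'D_(delta_mx i ord0) f x.

Definition partials (R : realType) n (s : seq 'I_n) (f : 'cV[R]_n -> R) :
    'cV[R]_n -> R :=
  foldr (@partial R n) f s.

(* U is meant to be open. The words s list the variables of differentiation in
   every order, so that all mixed partial derivatives are covered. *)
Definition Ck_on (R : realType) n (k : nat) (U : set 'cV[R]_n)
    (f : 'cV[R]_n -> R) : Prop :=
  forall s : seq 'I_n,
    ((size s <= k)%N -> forall x, U x -> {for x, continuous (partials s f)}) /\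
    ((size s < k)%N -> forall x, U x ->
       forall i, derivable (partials s f) x (delta_mx i ord0)).

Definition smooth (R : realType) n (f : 'cV[R]_n -> R) : Prop :=
  forall k, Ck_on k setT f.

Definition compactly_supported (R : realType) n (f : 'cV[R]_n -> R) : Prop :=
  compact (closure [set x | f x != 0]).

Definition mlength n (beta : {ffun 'I_n -> nat}) : nat := (\sum_i beta i)%N.

(* The derivatives are taken in a fixed order, which is immaterial for functions
   of class C^|beta|. *)
Definition mpartial (R : realType) n (beta : {ffun 'I_n -> nat})
    (f : 'cV[R]_n -> R) : 'cV[R]_n -> R :=
  partials (flatten [seq nseq (beta i) i | i <- enum 'I_n]) f.

Definition re_part (R : realType) (T : Type) (f : T -> R[i]) : T -> R :=
  fun x => complex.Re (f x).

Definition im_part (R : realType) (T : Type) (f : T -> R[i]) : T -> R :=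
  fun x => complex.Im (f x).

Definition cmpartial (R : realType) n (beta : {ffun 'I_n -> nat})
    (f : 'cV[R]_n -> R[i]) : 'cV[R]_n -> R[i] :=
  fun x => Complex (mpartial beta (re_part f) x) (mpartial beta (im_part f) x).

Definition cintegral (R : realType) n (f : 'cV[R]_n -> R[i]) : R[i] :=
  Complex (\int[lebesgue_cV n]_x re_part f x) (\int[lebesgue_cV n]_x im_part f x).

Definition expi (R : realType) (t : R) : R[i] := Complex (cos t) (sin t).

Definition fourier (R : realType) n (phi : 'cV[R]_n -> R) (xi : 'cV[R]_n) :
    R[i] :=
  cintegral (fun x => Complex (phi x) 0 *
    expi (- (2 * pi * (x^T *m xi) ord0 ord0))).

(* A kernel K is given by its multiplier Khat = \hat K; the value of Khat at 0,
   a null set, plays no role. *)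
Definition cz_multiplier (R : realType) m (n : nat) (Khat : 'cV[R]_m -> R[i]) :
    Prop :=
  [/\ Ck_on n [set eta | eta != 0] (re_part Khat),
      Ck_on n [set eta | eta != 0] (im_part Khat) &
      forall (beta : {ffun 'I_m -> nat}) (eta : 'cV[R]_m),
        (mlength beta <= n)%N -> eta != 0 ->
        Normc.normc (cmpartial beta Khat eta) <= enorm eta ^- mlength beta].

(* The principal value integral of phi(x) K(Pi x) over R^(2m), i.e. the pairing
   of phi with the tempered distribution K o Pi, computed on the Fourier side. *)
Definition pv_integral (R : realType) m (Pi : 'M[R]_(m, m + m))
    (Khat : 'cV[R]_m -> R[i]) (phi : 'cV[R]_(m + m) -> R) : R[i] :=
  cintegral (fun eta => fourier phi (- (Pi^T *m eta)) * Khat eta).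

Definition Lpnorm (R : realType) n (p : \bar R) (f : 'cV[R]_n -> R) : \bar R :=
  Lnorm (lebesgue_cV n) p (EFin \o f).

(* Main.v *)
(* Let m >= 2, let p_j = 2^(m-1) if j(1) = 0 and p_j = oo if j(1) = 1, and let
   Pi = (I I), so that Pi_j Pi^T = I for all j.  If every F_j is a tensor product
   of functions of one variable, the form becomes
     int Khat(eta) prod_i A_i^(-eta_i) B_i^(-eta_i) d eta,
   where A_i (resp. B_i) is the product of the i-th factors of the F_j with
   j(i) = 0 (resp. j(i) = 1).  For i >= 2 both are a fixed bump psi, but for i = 1
   the hypotheses only control A_1 in L^1 and B_1 in L^oo, and the unboundedness
   of singular integrals at these endpoints survives: take A_1(x) = psi(N x), let
   B_1 be the function 1_(-1,0) - 1_(0,1) smoothed at scale 1/N, and let Khat be a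
   small multiple of eta_1 / sqrt(1 + |eta|^2).  Up to a factor i the integrand has
   constant sign, and for |eta_i| <= 1 (i >= 2) and 1 <= |eta_1| <= N it is
   comparable to (1 - cos (2 pi eta_1)) / (N |eta_1|), whereas the product of the
   norms is comparable to 1 / N.  Hence the ratio grows like log N. *)
Require Import Defs.
From HB Require Import structures.
From mathcomp Require Import all_boot all_order all_algebra.
From mathcomp Require Import complex.
From mathcomp Require Import all_classical all_reals all_analysis.
From mathcomp Require Import measurable_realfun ess_sup_inf hoelder ring lra.

Set Implicit Arguments.
Unset Strict Implicit.
Unset Printing Implicit Defensive.

Import Order.TTheory GRing.Theory Num.Theory.
Import numFieldNormedType.Exports.

Local Open Scope classical_set_scope.
Local Open Scope ring_scope.

(** * Calculus of C^n and smooth functions on the line *)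

Section smooth_functions_of_one_variable.
Context {R : realType}.
Implicit Types f g : R -> R.

(** The exponents come from counting: A_1 is a product of 2^(m-1) functions, so with p = oo on the
    opposite face of the cube the reciprocals on this face must sum to 1, and equal exponents make
    the smallest of them as large as possible, namely 2^(m-1) > q. Taking these functions equal
    turns Hölder's inequality for A_1 into an equality, so no power of N is lost.

    Only the imaginary part of the form is estimated. All one-variable products except B_1 are even
    and have real transforms. B_1 is a second difference of an antiderivative of A_1 (up to
    scaling), so its transform contains that of A_1 again; the integrand then contains a square
    times 1 - cos, which fixes the sign without further knowledge of the bump.

    The real-valued integral is the [fine] part of an extended one, so integrals can be compared
    only once integrability is known. This is the purpose of the decay estimates: one derivative on
    each factor gives (1 + y^2)^(-1/2), and every variable carries two transforms. The logarithm
    appears as a partial sum of the harmonic series, one term for each unit interval of eta_1, which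
    is why N is finally a natural number. *)

Fixpoint Ck1 (n : nat) f : Prop :=
  if n is k.+1 then
    exists2 g : R -> R, (forall x : R, is_derive x 1 f (g x)) & Ck1 k g
  else continuous f.

Definition smooth1 f := forall n, Ck1 n f.

Lemma is_derive_continuous f g :
  (forall x : R, is_derive x 1 f (g x)) -> continuous f.
Proof.
by move=> fg x; apply/differentiable_continuous/derivable1_diffP; case: (fg x).
Qed.

Lemma Ck1_continuous n f : Ck1 n f -> continuous f.
Proof. by case: n => [//|n] [g /is_derive_continuous]. Qed.

Lemma smooth1_continuous f : smooth1 f -> continuous f.
Proof. by move=> /(_ 0%N). Qed.

Lemma Ck1W n f : Ck1 n.+1 f -> Ck1 n f.
Proof.
elim: n f => [|n IH] f; first exact: (@Ck1_continuous 1).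
by move=> [g fg /IH gn]; exists g.
Qed.

Lemma Ck1_cst n (c : R) : Ck1 n (fun=> c).
Proof.
elim: n c => [|n IH] c; first by move=> x; exact: cvg_cst.
exists (fun=> 0); last exact: IH.
by move=> x; exact: is_derive_cst.
Qed.

Lemma Ck1D n f g : Ck1 n f -> Ck1 n g -> Ck1 n (f \+ g).
Proof.
elim: n f g => [|n IH] f g; first by move=> cf cg x; apply: cvgD;
  [exact: cf|exact: cg].
by move=> [f' ff' nf'] [g' gg' ng']; exists (f' \+ g'); [move=> x;
  exact: is_deriveD|exact: IH].
Qed.

Lemma Ck1M n f g : Ck1 n f -> Ck1 n g -> Ck1 n (f \* g).
Proof.
elim: n f g => [|n IH] f g; first by move=> cf cg x; apply: cvgM;
  [exact: cf|exact: cg].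
move=> /[dup] /Ck1W nf [f' ff' nf'] /[dup] /Ck1W ng [g' gg' ng'].
exists (f \* g' \+ g \* f'); last by apply: Ck1D; exact: IH.
by move=> x; exact: is_deriveM.
Qed.

Lemma is_derive_affine (a b x : R) : is_derive x 1 (fun x => a * x + b) a.
Proof.
have := is_deriveD (is_deriveM (is_derive_cst a x 1) (is_derive_id x 1))
  (is_derive_cst b x 1).
by move=> /is_derive_eq; apply; rewrite addr0 scaler0 addr0 /cst [LHS]mulr1.
Qed.

Lemma is_derive_comp_affine f (f' a b x : R) :
  is_derive (a * x + b) 1 f f' -> is_derive x 1 (fun x => f (a * x + b)) (f' * a).
Proof.
by move=> ff'; exact: (@is_derive1_comp _ f _ x f' a ff'
  (is_derive_affine a b x)).
Qed.

Lemma continuous_comp_affine f (a b : R) :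
  continuous f -> continuous (fun x => f (a * x + b)).
Proof.
move=> cf x; apply: (@continuous_comp _ _ _ (fun x => a * x + b) f);
  last exact: cf.
exact: (is_derive_continuous (fun y => is_derive_affine a b y)).
Qed.

Lemma Ck1_comp_affine n f (a b : R) : Ck1 n f -> Ck1 n (fun x => f (a * x + b)).
Proof.
elim: n f => [|n IH] f; first exact: continuous_comp_affine.
move=> [g fg /IH ng]; exists ((fun x => g (a * x + b)) \* cst a).
  by move=> x; exact: is_derive_comp_affine.
by apply: Ck1M => //; exact: Ck1_cst.
Qed.

Lemma Ck1X n k f : Ck1 n f -> Ck1 n (fun x => f x ^+ k).
Proof.
move=> nf; elim: k => [|k IH]; first exact: Ck1_cst.
rewrite (_ : (fun _ => _) = f \* (fun x => f x ^+ k)); first exact: Ck1M.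
by apply/funext => x /=; rewrite exprS.
Qed.

Lemma Ck1S_derive1 n f : Ck1 n.+1 f -> Ck1 n (derive1 f).
Proof.
move=> [g fg ng]; rewrite (_ : (derive1 f) = g) //.
by apply/funext => x; rewrite derive1E; exact: derive_val.
Qed.

Lemma smooth1_derive1n f k : smooth1 f -> smooth1 (derive1n k f).
Proof.
elim: k => [|k IH] sf; first by rewrite derive1n0.
by rewrite derive1nS => n; apply: Ck1S_derive1; exact: IH.
Qed.

Lemma smooth1_is_derive f (x : R) : smooth1 f -> is_derive x 1 f (derive1 f x).
Proof.
by move=> /(_ 1%N)[g fg _]; rewrite derive1E; apply: derivableP; case: (fg x).
Qed.

Lemma smooth1_primitive f g :
  (forall x : R, is_derive x 1 f (g x)) -> smooth1 g -> smooth1 f.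
Proof.
by move=> fg sg [|n]; [exact: is_derive_continuous fg|exists g].
Qed.

End smooth_functions_of_one_variable.

(** * A smooth even bump built from exp(-1/x) *)

Section bump.
Context {R : realType}.

(* The derivative of [flat k] is a combination of [flat k.+2] and [flat k.+1], so
   that smoothness is proved for all [k] at once. *)
Definition flat (k : nat) (x : R) : R :=
  if 0 < x then x ^- k * expR (- x^-1) else 0.

Lemma flat_ge0 k x : 0 <= flat k x.
Proof.
by rewrite /flat; case: ifP => // x0;
  rewrite mulr_ge0 ?expR_ge0// invr_ge0 exprn_ge0 // ltW.
Qed.

(** The term of degree k + 2 in the exponential series at 1/x already beats x^(-k) by a factor
    x^(-2). The quadratic bound makes the difference quotient of [flat k] at 0 tend to 0. *)
Lemma flat_le k x : `|flat k x| <= (k.+2)`!%:R * x ^+ 2.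
Proof.
rewrite ger0_norm ?flat_ge0// /flat; case: ifP => x0; last first.
  by rewrite mulr_ge0 // sqr_ge0.
have e0 := expR_gt0 x^-1.
have xk : 0 < x ^+ k by rewrite exprn_gt0.
have fk : 0 < (k.+2)`!%:R :> R by rewrite ltr0n fact_gt0.
have := @expR_ge1Dxn R x^-1 k.+1; rewrite invr_ge0 ltW// => /(_ isT) h.
have {}h : x^-1 ^+ k.+2 / (k.+2)`!%:R <= expR x^-1 by apply: le_trans h;
  rewrite lerDr.
move: h; rewrite ler_pdivrMr // exprVn => h.
rewrite expRN mulrC ler_pdivrMl // mulrCA.
rewrite -[X in X <= _]mul1r -ler_pdivlMr ?invr_gt0// invrK.
rewrite mulrA -[X in _ <= X]mulrA -exprD add2n.
by move: h; rewrite -[_ ^- _]mul1r ler_pdivrMr ?exprn_gt0 // [X in X * _]mulrC.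
Qed.

Lemma is_derive_flat k (x : R) : is_derive x 1 (flat k)
  (flat k.+2 x - k%:R * flat k.+1 x).
Proof.
have [x0|x0|->] := ltgtP x 0.
- have -> : flat k.+2 x - k%:R * flat k.+1 x = 0
    by rewrite /flat ltNge ltW//= mulr0 subr0.
  apply: (@near_eq_is_derive _ _ _ (cst 0)).
  by near=> y; rewrite /flat ltNge ltW//=; near: y; exact: lt_nbhsl.
- have F : is_derive x 1 (fun y : R => (y ^+ k)^-1 * expR (- y^-1))
     (flat k.+2 x - k%:R * flat k.+1 x).
    have xk : x ^+ k != 0 by rewrite expf_neq0 // gt_eqF.
    have D0 : is_derive x 1 (fun y : R => y ^+ k) (k%:R * x ^+ k.-1).
      have := is_deriveX k (is_derive_id x 1);
        rewrite exprfctE => /is_derive_eq; apply.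
      by rewrite [LHS]mulr1.
    have D1 := @is_deriveV R (fun y => y ^+ k) x _ 1 xk D0.
    have D2 := is_deriveN (@is_deriveV R id x _ 1 (lt0r_neq0 x0)
      (is_derive_id x 1)).
    have D3 := @is_derive1_comp _ expR (fun y => - y^-1) x _ _
      (is_derive_expR _) D2.
    have := is_deriveM D1 D3.
    move=> /is_derive_eq; apply.
    rewrite /flat x0 /=.
    have x00 : x != 0 by rewrite gt_eqF.
    rewrite /GRing.scale/=.
    case: k {D0 D1 xk} => [|k]; rewrite ?mulr0n /=; first by field.
    rewrite !exprS -mulr_natr; field.
    by rewrite x00 expf_neq0.
  apply: near_eq_is_derive F.
  by near=> y; rewrite /flat ifT // -oppr_lt0; near: y; apply: Nlt_nbhsl;
    rewrite oppr_lt0.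
- rewrite /flat !ltxx mulr0 subr0.
  apply/is_derive1_caratheodory.
  (* Carathéodory's slope at 0. Its value at z = 0 is 0, which is also the claimed derivative, so
     only its continuity at 0 remains; this is where [flat_le] enters. *)
  exists (fun z => flat k z / z); split.
  + move=> z; rewrite /flat ltxx !subr0.
    by have [->|z0] := eqVneq z 0; [rewrite mulr0 ltxx|rewrite divfK].
  + suff L : flat k z / z @[z --> nbhs (0 : R)] --> (0 : R).
      have E : (fun z => flat k z / z) 0 = 0 by rewrite /= invr0 mulr0.
      by rewrite /prop_for /continuous_at E.
    apply/cvgr0Pnorm_le => e e0.
    have C0 : 0 < (k.+2)`!%:R :> R by rewrite ltr0n fact_gt0.
    have d0 : 0 < (k.+2)`!%:R^-1 * e by rewrite mulr_gt0 ?invr_gt0.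
    apply: filterS (nbhs0_le d0) => z zd.
    have [->|z0] := eqVneq z 0; first by rewrite invr0 mulr0 normr0 ltW.
    rewrite normrM normfV ler_pdivrMr ?normr_gt0//.
    apply: le_trans (flat_le k z) _.
    rewrite -[z ^+ 2]ger0_norm ?sqr_ge0// normrX expr2 mulrA.
    apply: ler_wpM2r => //.
    by rewrite -ler_pdivlMl.
  + by rewrite invr0 mulr0.
Unshelve. all: by end_near. Qed.

Lemma smooth1_flat k : smooth1 (flat k).
Proof.
move=> n; elim: n k => [|n IH] k.
  by apply: is_derive_continuous => x; exact: is_derive_flat.
exists (flat k.+2 \+ cst (- k%:R) \* flat k.+1).
  by move=> x /=; rewrite /cst /= mulNr; exact: is_derive_flat.
by apply: Ck1D => //; apply: Ck1M => //; exact: Ck1_cst.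
Qed.

(** The radius 1/8 of the support keeps the phase 2 pi x y within pi/4 whenever |x| <= 1/(8N) and
    |y| <= N. The arguments have the shape [a * x + b] of [Ck1_comp_affine]. *)
Definition bump (x : R) : R := flat 0 (1 * x + 8^-1) * flat 0 (-1 * x + 8^-1).

Lemma smooth1_bump : smooth1 bump.
Proof. by move=> n; apply: Ck1M; apply: Ck1_comp_affine; exact: smooth1_flat. Qed.

Lemma bump_ge0 x : 0 <= bump x.
Proof. by rewrite mulr_ge0 ?flat_ge0. Qed.

Lemma flat0_le1 x : flat 0 x <= 1.
Proof.
rewrite /flat; case: ifP => // x0; rewrite expr0 invr1 mul1r expR_le1.
by rewrite oppr_le0 invr_ge0 ltW.
Qed.

Lemma bump_le1 x : bump x <= 1.
Proof. by rewrite mulr_ile1 ?flat_ge0 ?flat0_le1. Qed.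

Lemma bumpN x : bump (- x) = bump x.
Proof. by rewrite /bump !mulN1r !mul1r opprK mulrC. Qed.

Lemma bump_out x : 8^-1 <= `|x| -> bump x = 0.
Proof.
rewrite /bump /flat mul1r mulN1r.
case: ltP => h1; last by rewrite mul0r.
case: ltP => h2; last by rewrite mulr0.
rewrite real_ler_normr ?num_real// => /orP[]; lra.
Qed.

Lemma bump0 : 0 < bump 0.
Proof.
rewrite /bump /flat !mulr0 !add0r invr_gt0 ltr0n /= expr0 invr1 mul1r.
by rewrite mulr_gt0 ?expR_gt0.
Qed.

End bump.

(** * Integration by parts, primitives, translation and reflection for compactly supported
    functions *)

Section integrals_of_compactly_supported_functions.
Context {R : realType}.
Local Notation mu := (@lebesgue_measure R).
Implicit Types (f g : R -> R) (L x c : R).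

Definition vanishes L f := forall x, L <= `|x| -> f x = 0.

Lemma vanishesW L L' f : L <= L' -> vanishes L f -> vanishes L' f.
Proof. by move=> LL' fL x L'x; apply: fL; exact: le_trans L'x. Qed.

Lemma vanishesMl L f g : vanishes L f -> vanishes L (f \* g).
Proof. by move=> fL x /fL /= ->; rewrite mul0r. Qed.

Lemma vanishes_notin L f x : vanishes L f -> x \notin `[- L, L] -> f x = 0.
Proof.
move=> fL; rewrite in_itv/= -ler_norml -ltNge => /ltW; exact: fL.
Qed.

Lemma patch_vanishes L f : vanishes L f -> f \_ `[- L, L] = f.
Proof.
move=> fL; apply/funext => x; rewrite patchE; case: ifPn => // /negP xL.
by apply/esym/(vanishes_notin fL)/negP => xL'; apply: xL; rewrite inE.
Qed.

Lemma integrable_vanishes L f : continuous f -> vanishes L f ->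
  mu.-integrable setT (EFin \o f).
Proof.
move=> cf fL; rewrite -(patch_vanishes fL) -restrict_EFin.
have [+ _] := @integrable_mkcond _ _ R mu `[- L, L] (EFin \o f)
  (measurable_itv _); apply.
apply: (@continuous_compact_integrable R f).
  exact: segment_compact.
exact: continuous_subspaceT.
Qed.

Lemma FTC2_continuous f g (a b : R) : a < b -> continuous g ->
  (forall x : R, is_derive x 1 f (g x)) ->
  (\int[mu]_(x in `[a, b]) (g x)%:E = (f b)%:E - (f a)%:E)%E.
Proof.
move=> ab cg fg; have cf := is_derive_continuous fg.
apply: continuous_FTC2 => //.
- exact: continuous_subspaceT.
- split; first by move=> x _; case: (fg x).
  + exact/cvg_at_right_filter/cf.
  + exact/cvg_at_left_filter/cf.
- by move=> x _; rewrite derive1E; exact: derive_val.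
Qed.

Lemma Rintegral_vanishes L f g : 0 < L -> continuous g -> vanishes L g ->
  (forall x : R, is_derive x 1 f (g x)) ->
  \int[mu]_x g x = f L - f (- L).
Proof.
move=> L0 cg gL fg.
rewrite -(patch_vanishes gL) -Rintegral_mkcond /Rintegral.
by rewrite (@FTC2_continuous f) //; lra.
Qed.

Lemma Rintegral_by_parts L f f' g g' : 0 < L ->
  vanishes L f -> vanishes L f' -> continuous f' -> continuous g' ->
  (forall x : R, is_derive x 1 f (f' x)) ->
  (forall x : R, is_derive x 1 g (g' x)) ->
  \int[mu]_x (f' x * g x) = - \int[mu]_x (f x * g' x).
Proof.
move=> L0 fL f'L cf' cg' ff' gg'.
have cf := is_derive_continuous ff'; have cg := is_derive_continuous gg'.
have cM (h k : R -> R) : continuous h -> continuous k -> continuous (h \* k).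
  by move=> ch ck x; apply: cvgM; [exact: ch|exact: ck].
have D x : is_derive x 1 (f \* g) ((f \* g' \+ f' \* g) x).
  have := is_deriveM (ff' x) (gg' x).
  by move=> /is_derive_eq; apply; rewrite /= [X in _ + X]mulrC.
apply/eqP; rewrite -addr_eq0 addrC -RintegralD//=.
- rewrite (Rintegral_vanishes L0 _ _ D).
  + by rewrite /= (fL L) ?(fL (- L)) ?normrN ?ger0_norm ?(ltW L0)// !mul0r subrr.
  + by move=> x; apply: cvgD; [exact: (cM _ _ cf cg')|exact: (cM _ _ cf' cg)].
  + by move=> x /[dup] /fL /= -> /f'L ->; rewrite !mul0r addr0.
- by apply: (@integrable_vanishes L (f \* g')); [exact: cM|exact: vanishesMl].
- by apply: (@integrable_vanishes L (f' \* g)); [exact: cM|exact: vanishesMl].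
Qed.

Definition primitive f x : R := \int[mu]_(t in `]-oo, x]) f t.

Section primitive.
Variables (L : R) (f : R -> R).
Hypotheses (cf : continuous f) (fL : vanishes L f).

Let intf A : measurable A -> mu.-integrable A (EFin \o f).
Proof.
by move=> mA; apply: integrableS (integrable_vanishes cf fL) => //.
Qed.

Lemma is_derive_primitive x : is_derive x 1 (primitive f) (f x).
Proof.
have /= [] := @continuous_FTC1 R f -oo%O x (x + 1).
- by rewrite ltrDl.
- exact: intf.
- by rewrite ltNyr.
- exact: cf.
by rewrite derive1E => d <-; exact: derivableP.
Qed.

Lemma primitive_left x : x <= - L -> primitive f x = 0.
Proof.
move=> xL; rewrite /primitive (@eq_Rintegral _ _ _ _ _ (cst 0)).
  by rewrite /Rintegral integral0.
move=> y; rewrite inE/= in_itv/= => yx; apply: fL.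
rewrite real_ler_normr ?num_real//; apply/orP; right; lra.
Qed.

Lemma primitive_right x : L <= x -> primitive f x = \int[mu]_t f t.
Proof.
move=> Lx; rewrite /primitive Rintegral_mkcond; apply: eq_Rintegral => y _.
rewrite patchE; case: ifPn => // /negP yx; apply/esym/fL.
rewrite real_ler_normr ?num_real//; apply/orP; left.
have : ~ y <= x by move=> h; apply: yx; rewrite inE/= in_itv.
move/negP; rewrite -ltNge; lra.
Qed.

Hypothesis f0 : forall x, 0 <= f x.

Lemma primitive_ge0 x : 0 <= primitive f x.
Proof. exact: Rintegral_ge0. Qed.

Lemma primitive_le x : primitive f x <= \int[mu]_t f t.
Proof.
rewrite /primitive Rintegral_mkcond; apply: le_Rintegral => //.
- rewrite -restrict_EFin.
  by have [+ _] := @integrable_mkcond _ _ R mu `]-oo, x] (EFin \o f)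
    (measurable_itv _); apply; exact: intf.
- exact: intf.
- by move=> y _; rewrite patchE; case: ifPn.
Qed.

End primitive.

Lemma Rintegral_primitive L f : 0 < L -> continuous f -> vanishes L f ->
  forall c d, L <= c -> L <= d ->
  primitive f c - primitive f (- d) = \int[mu]_x f x.
Proof.
move=> L0 cf fL c d Lc Ld.
by rewrite (primitive_right fL Lc) (primitive_left fL) ?subr0// lerN2.
Qed.

(** Both integrals are increments of [primitive f]: after the shift the endpoints M + c and -M + c,
    with M = L + |c|, still lie beyond L and -L, where the primitive is constant. *)
Lemma Rintegral_translation L f c : 0 < L -> continuous f -> vanishes L f ->
  \int[mu]_x f (x + c) = \int[mu]_x f x.
Proof.
move=> L0 cf fL; pose M := L + `|c|.
have c0 := normr_ge0 c.
have D x : is_derive x 1 (fun x => primitive f (1 * x + c)) (f (1 * x + c) * 1).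
  by apply: is_derive_comp_affine; exact: is_derive_primitive fL _.
under eq_Rintegral do rewrite -[X in f (X + c)]mul1r -[f _]mulr1.
have h1 := ler_norm c; have h2 := ler_norm (- c); rewrite normrN in h2.
have vM : vanishes M (fun x => f (1 * x + c) * 1).
  move=> x; rewrite /M mulr1 mul1r => xM; apply: fL.
  have := ler_normB (x + c) c; rewrite addrK; lra.
rewrite (Rintegral_vanishes _ _ vM D); last 2 first.
- by rewrite /M; lra.
- under eq_fun do rewrite mulr1.
  exact: continuous_comp_affine.
rewrite !mul1r (_ : - M + c = - (M - c)); last by ring.
by apply: (@Rintegral_primitive L) => //; rewrite /M; lra.
Qed.

Lemma Rintegral_reflection L f : 0 < L -> continuous f -> vanishes L f ->
  \int[mu]_x f (- x) = \int[mu]_x f x.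
Proof.
move=> L0 cf fL.
have D x : is_derive x 1 (fun x => - primitive f (-1 * x + 0)) (f (-1 * x + 0)).
  have := is_deriveN (is_derive_comp_affine (is_derive_primitive cf fL
    (-1 * x + 0))).
  by move=> /is_derive_eq; apply; rewrite mulrN1 opprK.
under eq_Rintegral do rewrite -[- _]mulN1r -[X in f X]addr0.
rewrite (Rintegral_vanishes L0 _ _ D).
- rewrite !addr0 !mulN1r opprK opprK addrC.
  exact: (@Rintegral_primitive L).
- exact: continuous_comp_affine.
- by move=> x xL; apply: fL; rewrite addr0 mulN1r normrN.
Qed.

End integrals_of_compactly_supported_functions.

(** * Cosine and sine transforms on the line and their decay *)

Section fourier_transform_on_the_line.
Context {R : realType}.
Local Notation mu := (@lebesgue_measure R).
Implicit Types (f g : R -> R) (L x y c : R).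

(** The Fourier transform of a real [f] is [cosT f - i * sinT f]; the two parts are kept apart so
    that the analysis stays real. *)
Definition cosT f y : R := \int[mu]_x (f x * cos (2 * pi * (x * y))).
Definition sinT f y : R := \int[mu]_x (f x * sin (2 * pi * (x * y))).

Lemma is_derive_phase x y : is_derive x 1 (fun x => 2 * pi * (x * y))
  (2 * pi * y).
Proof.
rewrite (_ : (fun x => _) = (fun x => 2 * pi * y * x + 0));
  first exact: is_derive_affine.
by apply/funext => z; ring.
Qed.

Lemma is_derive_cos_phase x y :
  is_derive x 1 (fun x => cos (2 * pi * (x * y))) (- (2 * pi * y) * sin
    (2 * pi * (x * y))).
Proof.
have := @is_derive1_comp R cos (fun x => 2 * pi * (x * y)) x _ _
  (is_derive_cos (2 * pi * (x * y))) (is_derive_phase x y).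
by move=> /is_derive_eq; apply; ring.
Qed.

Lemma is_derive_sin_phase x y :
  is_derive x 1 (fun x => sin (2 * pi * (x * y))) ((2 * pi * y) * cos
    (2 * pi * (x * y))).
Proof.
have := @is_derive1_comp R sin (fun x => 2 * pi * (x * y)) x _ _
  (is_derive_sin (2 * pi * (x * y))) (is_derive_phase x y).
by move=> /is_derive_eq; apply; ring.
Qed.

Lemma continuous_cos_phase y : continuous (fun x => cos (2 * pi * (x * y))).
Proof. exact: is_derive_continuous (fun x => is_derive_cos_phase x y). Qed.

Lemma continuous_sin_phase y : continuous (fun x => sin (2 * pi * (x * y))).
Proof. exact: is_derive_continuous (fun x => is_derive_sin_phase x y). Qed.

Lemma continuousM1 f g : continuous f -> continuous g -> continuous (f \* g).
Proof. by move=> cf cg x; apply: cvgM; [exact: cf|exact: cg]. Qed.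

Section continuous.
Variables (L : R) (f : R -> R).
Hypotheses (cf : continuous f) (fL : vanishes L f).

Lemma integrable_norm_vanishes : mu.-integrable setT (EFin \o (fun x => `|f x|)).
Proof.
apply: (@integrable_vanishes _ L) => [x|x /fL ->]; last by rewrite normr0.
apply: continuous_comp; [exact: cf|exact: norm_continuous].
Qed.

Lemma integrable_cos_phase y :
  mu.-integrable setT (EFin \o (fun x => f x * cos (2 * pi * (x * y)))).
Proof.
apply: (@integrable_vanishes _ L); last exact: vanishesMl.
exact: continuousM1 cf (@continuous_cos_phase y).
Qed.

Lemma integrable_sin_phase y :
  mu.-integrable setT (EFin \o (fun x => f x * sin (2 * pi * (x * y)))).
Proof.
apply: (@integrable_vanishes _ L); last exact: vanishesMl.
exact: continuousM1 cf (@continuous_sin_phase y).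
Qed.

Lemma continuous_cosT : continuous (cosT f).
Proof.
move=> y.
apply: (@continuity_under_integral R _ _ mu (fun y x => f x * cos (2 * pi *
  (x * y)))
  setT measurableT (y - 1) (y + 1) _ _ (fun x => `|f x|)).
- by move=> z _; exact: integrable_cos_phase.
- apply: aeW => x _ z _; apply: cvgMr.
  have -> : (fun y => cos (2 * pi * (x * y))) = (fun y => cos (2 * pi * (y * x))).
    by apply/funext => w; rewrite [x * w]mulrC.
  by rewrite [x * z]mulrC; exact: continuous_cos_phase.
- exact: integrable_norm_vanishes.
- by move=> z _; apply: aeW => x _; rewrite normrM ler_piMr// cos_max.
- by rewrite inE/= in_itv/=; lra.
Qed.

Lemma continuous_sinT : continuous (sinT f).
Proof.
move=> y.
apply: (@continuity_under_integral R _ _ mu (fun y x => f x * sin (2 * pi *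
  (x * y)))
  setT measurableT (y - 1) (y + 1) _ _ (fun x => `|f x|)).
- by move=> z _; exact: integrable_sin_phase.
- apply: aeW => x _ z _; apply: cvgMr.
  have -> : (fun y => sin (2 * pi * (x * y))) = (fun y => sin (2 * pi * (y * x))).
    by apply/funext => w; rewrite [x * w]mulrC.
  by rewrite [x * z]mulrC; exact: continuous_sin_phase.
- exact: integrable_norm_vanishes.
- by move=> z _; apply: aeW => x _; rewrite normrM ler_piMr// sin_max.
- by rewrite inE/= in_itv/=; lra.
Qed.

Lemma cosT_le y : `|cosT f y| <= \int[mu]_x `|f x|.
Proof.
apply: le_trans (le_normr_Rintegral measurableT (integrable_cos_phase y)) _.
apply: le_Rintegral => //.
- have := integrable_cos_phase y => /integrable_abse.
  by apply: eq_integrable => // x _ /=.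
- exact: integrable_norm_vanishes.
- by move=> x _; rewrite normrM ler_piMr// cos_max.
Qed.

Lemma sinT_le y : `|sinT f y| <= \int[mu]_x `|f x|.
Proof.
apply: le_trans (le_normr_Rintegral measurableT (integrable_sin_phase y)) _.
apply: le_Rintegral => //.
- have := integrable_sin_phase y => /integrable_abse.
  by apply: eq_integrable => // x _ /=.
- exact: integrable_norm_vanishes.
- by move=> x _; rewrite normrM ler_piMr// sin_max.
Qed.

Hypothesis L0 : 0 < L.

Lemma cosT_translation c y : cosT (fun x => f (x + c)) y =
  cos (2 * pi * (c * y)) * cosT f y + sin (2 * pi * (c * y)) * sinT f y.
Proof.
pose h x := f x * cos (2 * pi * ((x - c) * y)).
have -> : cosT (fun x => f (x + c)) y = \int[mu]_x h (x + c).
  by apply: eq_Rintegral => x _; rewrite /h addrK.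
rewrite (@Rintegral_translation _ L) //; last 2 first.
- apply: continuousM1 => //.
  rewrite (_ : (fun x => _) = (fun x => cos (2 * pi * ((1 * x - c) * y)))).
    exact: (@continuous_comp_affine R (fun z => cos (2 * pi * (z * y))) 1
      (- c) (@continuous_cos_phase y)).
  by apply/funext => x; rewrite mul1r.
- by apply: vanishesMl.
rewrite -!RintegralZl//=; [|exact: integrable_sin_phase|exact:
  integrable_cos_phase].
rewrite -RintegralD//=.
- apply: eq_Rintegral => x _ /=.
  by rewrite /h mulrBl mulrBr cosB; ring.
- apply: (@integrable_vanishes _ L).
    by apply: continuousM1; [move=> ?;
      exact: cvg_cst|exact: continuousM1 (@continuous_cos_phase y)].
  by move=> x /fL ->; rewrite mul0r mulr0.
- apply: (@integrable_vanishes _ L).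
    by apply: continuousM1; [move=> ?;
      exact: cvg_cst|exact: continuousM1 (@continuous_sin_phase y)].
  by move=> x /fL ->; rewrite mul0r mulr0.
Qed.

Lemma sinT_even y : (forall x, f (- x) = f x) -> sinT f y = 0.
Proof.
move=> fe; have : sinT f y = - sinT f y; last by lra.
rewrite {1}/sinT -(@Rintegral_reflection _ L (fun x => f x * sin (2 * pi *
  (x * y)))) //;
  last exact: vanishesMl.
- rewrite -mulN1r -RintegralZl//; last exact: integrable_sin_phase.
  by apply: eq_Rintegral => x _; rewrite fe mulNr mulrN sinN; ring.
- exact: continuousM1 cf (@continuous_sin_phase y).
Qed.

End continuous.

Lemma cosTN f y : cosT f (- y) = cosT f y.
Proof. by apply: eq_Rintegral => x _; rewrite mulrN mulrN cosN. Qed.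

Lemma sinTN L f y : continuous f -> vanishes L f -> sinT f (- y) = - sinT f y.
Proof.
move=> cf fL; rewrite /sinT -[RHS]mulN1r -RintegralZl//;
  last exact: integrable_sin_phase fL _.
by apply: eq_Rintegral => x _; rewrite mulrN mulrN sinN; ring.
Qed.

Section derivative.
Variables (L : R) (f f' : R -> R).
Hypotheses (L0 : 0 < L) (ff' : forall x : R, is_derive x 1 f (f' x)).
Hypotheses (cf' : continuous f') (fL : vanishes L f) (f'L : vanishes L f').

Let cf : continuous f. Proof. exact: is_derive_continuous ff'. Qed.

Lemma cosT_derive y : cosT f' y = 2 * pi * y * sinT f y.
Proof.
rewrite /cosT (@Rintegral_by_parts _ L f f' _ _ L0 fL f'L cf' _ ff'
  (fun x => is_derive_cos_phase x y)).
  rewrite -mulN1r -!RintegralZl//; last 2 first.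
  - exact: integrable_sin_phase fL _.
  - apply: (@integrable_vanishes _ L); last exact: vanishesMl.
    apply: continuousM1 => //; apply: continuousM1; first by move=> ?;
      exact: cvg_cst.
    exact: continuous_sin_phase.
  by apply: eq_Rintegral => x _; ring.
apply: continuousM1; first by move=> ?; exact: cvg_cst.
exact: continuous_sin_phase.
Qed.

Lemma sinT_derive y : sinT f' y = - (2 * pi * y * cosT f y).
Proof.
rewrite /sinT (@Rintegral_by_parts _ L f f' _ _ L0 fL f'L cf' _ ff'
  (fun x => is_derive_sin_phase x y)).
  congr (- _); rewrite -!RintegralZl//; last exact: integrable_cos_phase fL _.
  by apply: eq_Rintegral => x _; ring.
apply: continuousM1; first by move=> ?; exact: cvg_cst.
exact: continuous_cos_phase.
Qed.

(** Here [k] stands for a transform at [y], and [2 * pi * y * k] is up to sign a transform of the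
    derivative. Since 2 pi >= 1 that factor may be dropped, and adding the squares of the two bounds
    gives the weight 1 + y^2. *)
Lemma transform_decay (k : R) (C C' y : R) : `|k| <= C ->
  `|2 * pi * y * k| <= C' ->
  `|k| ^+ 2 * (1 + y ^+ 2) <= C ^+ 2 + C' ^+ 2.
Proof.
move=> kC kC'.
have C0 : 0 <= C by apply: le_trans kC.
have k2 : `|k| ^+ 2 <= C ^+ 2 by rewrite lerXn2r ?nnegrE.
have E : `|2 * pi * y * k| = 2 * pi * (`|y| * `|k|).
  by rewrite !normrM (ger0_norm (pi_ge0 R)) ger0_norm// !mulrA.
have yk0 : 0 <= `|y| * `|k| by rewrite mulr_ge0.
have yk : `|y| * `|k| <= C'.
  by apply: le_trans kC'; rewrite E; have := pi_ge2 R; nra.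
have k2' : (`|y| * `|k|) ^+ 2 <= C' ^+ 2.
  by rewrite lerXn2r ?nnegrE// (le_trans yk0).
by move: k2'; rewrite exprMn real_normK ?num_real//; lra.
Qed.

Lemma cosT_decay : exists C, forall y, `|cosT f y| ^+ 2 * (1 + y ^+ 2) <= C.
Proof.
eexists => y; apply: transform_decay; first exact: cosT_le fL y.
by rewrite -normrN -sinT_derive; exact: sinT_le f'L y.
Qed.

Lemma sinT_decay : exists C, forall y, `|sinT f y| ^+ 2 * (1 + y ^+ 2) <= C.
Proof.
eexists => y; apply: transform_decay; first exact: sinT_le fL y.
by rewrite -cosT_derive; exact: cosT_le f'L y.
Qed.

End derivative.

Lemma integrable_oneDsqrV : mu.-integrable setT (EFin \o (fun x =>
  (1 + x ^+ 2)^-1)).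
Proof.
have -> : (fun x => (1 + x ^+ 2)^-1) = (fun x => (oneDsqr x)^-1 : R) by [].
apply/integrableP; split.
  apply/(measurable_EFinP _ _); apply: continuous_measurable_fun.
  exact: continuous_oneDsqrV.
under eq_integral => x _ do rewrite /= ger0_norm ?invr_ge0 ?(le_trans _
  (oneDsqr_ge1 x))//.
rewrite (@ge0_symfun_integralT R (fun x => (oneDsqr x)^-1)).
- by rewrite -set_itvcy integral0y_oneDsqr ltry.
- by move=> x; rewrite invr_ge0 (le_trans _ (oneDsqr_ge1 x)).
- exact: continuous_oneDsqrV.
- by move=> x /=; rewrite /oneDsqr sqrrN.
Qed.

(** From 2 |h k| <= h^2 + k^2 the product is dominated by (C + D) / (1 + y^2): two factors of order
    (1 + y^2)^(-1/2) suffice together. *)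
Lemma integrable_square_decay (h k : R -> R) :
  continuous h -> continuous k ->
  (exists C, forall y, `|h y| ^+ 2 * (1 + y ^+ 2) <= C) ->
  (exists C, forall y, `|k y| ^+ 2 * (1 + y ^+ 2) <= C) ->
  mu.-integrable setT (EFin \o (h \* k)).
Proof.
move=> ch ck [C hC] [D kD].
apply: (@le_integrable _ _ R mu setT measurableT _ (EFin \o (fun x : R =>
  (C + D) * (1 + x ^+ 2)^-1))).
- apply/(measurable_EFinP _ _); apply: continuous_measurable_fun.
  exact: continuousM1.
- move=> x _; rewrite /= lee_fin normrM.
  have x1 : 0 < 1 + x ^+ 2 by have := sqr_ge0 x; lra.
  apply: le_trans (ler_norm _); rewrite ler_pdivlMr//.
  apply: le_trans (lerD (hC x) (kD x)).
  rewrite -mulrDl ler_pM2r//.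
  have := sqr_ge0 (`|h x| - `|k x|); have := normr_ge0 (h x);
    have := normr_ge0 (k x); nra.
- have := @integrableZl _ _ R mu setT measurableT (C + D) _ integrable_oneDsqrV.
  by apply: eq_integrable => // x _ /=.
Qed.

End fourier_transform_on_the_line.

(** * Fubini for tensor products on R^n, real and complex *)

Section integrals_of_tensor_products.
Context {R : realType}.
Local Notation mu := (@lebesgue_measure R).

Lemma measurable_cV_cons n (g : R -> R) (h : 'cV[R]_n -> R) :
  measurable_fun setT g -> measurable_fun setT h ->
  measurable_fun setT (fun v : 'cV[R]_n.+1 => g (v ord0 ord0) * h (\col_k v
    (lift ord0 k) ord0)).
Proof.
move=> mg mh; apply: measurable_funM.
  by apply: measurableT_comp => //; exact: (measurable_coord_cV ord0).
apply: measurableT_comp => //; apply: measurable_to_cV => k.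
under eq_fun do rewrite mxE.
exact: (measurable_coord_cV (lift ord0 k)).
Qed.

Lemma integral_cV_succ n (f : 'cV[R]_n.+1 -> \bar R) :
  measurable_fun setT f ->
  (mu \x lebesgue_cV n)%E.-integrable setT (f \o @cons_cV R n) ->
  (lebesgue_cV n.+1).-integrable setT f /\
  (\int[lebesgue_cV n.+1]_v f v = \int[mu \x lebesgue_cV n]_z f (cons_cV z))%E.
Proof.
move=> mf intf.
have mc : measurable_fun [set: measurableTypeR R * 'cV[R]_n] (@cons_cV R n).
  exact: measurable_cons_cV.
split.
  have := integrable_pushforward mc mf intf measurableT.
  by move=> /integrableP[_ foo]; apply/integrableP; split.
exact: (integral_pushforward mc mf intf measurableT).
Qed.

(** The measure on R^(n+1) is the image of a product measure under [cons_cV]. Integrability on the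
    product follows from the iterated integral of the absolute value, and Fubini then separates the
    factors. *)
Lemma integral_cV_cons n (g : R -> R) (h : 'cV[R]_n -> R) :
  mu.-integrable setT (EFin \o g) ->
  (lebesgue_cV n).-integrable setT (EFin \o h) ->
  let f := fun v : 'cV[R]_n.+1 => g (v ord0 ord0) * h (\col_k v
    (lift ord0 k) ord0) in
  (lebesgue_cV n.+1).-integrable setT (EFin \o f) /\
  \int[lebesgue_cV n.+1]_v f v = (\int[mu]_x g x) * (\int[lebesgue_cV n]_v h v).
Proof.
move=> ig ih f.
have mg : measurable_fun setT g by apply/(measurable_EFinP _ _);
  case/integrableP: ig.
have mh : measurable_fun setT h by apply/(measurable_EFinP _ _);
  case/integrableP: ih.
have mf : measurable_fun setT (EFin \o f).
  by apply/(measurable_EFinP _ _); exact: measurable_cV_cons.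
have fE : (EFin \o f) \o @cons_cV R n = (fun z => (g z.1 * h z.2)%:E).
  apply/funext => -[x v] /=; rewrite /f mxE unlift_none; congr (_ * h _)%:E.
  by apply/matrixP => i j; rewrite !mxE liftK (ord1 j).
have int2 : (mu \x lebesgue_cV n)%E.-integrable setT (fun z =>
  (g z.1 * h z.2)%:E).
  apply/integrable12ltyP.
    rewrite -fE; exact: measurableT_comp mf (@measurable_cons_cV R n).
  have -> : (fun x => \int[lebesgue_cV n]_y `|(g (x, y).1 * h (x, y).2)%:E|)%E =
     (fun x => `|(g x)%:E| * \int[lebesgue_cV n]_y `|(h y)%:E|)%E.
    apply/funext => x /=.
    under eq_integral do rewrite normrM EFinM.
    rewrite ge0_integralZl//.
    by apply/(measurable_EFinP _ _); exact: measurableT_comp.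
  have [_ hoo] := (integrableP _ _ _ ih); have [_ goo] := (integrableP _ _ _ ig).
  rewrite ge0_integralZr//.
  - by rewrite lte_mul_pinfty// ?integral_ge0// ge0_fin_numE ?integral_ge0.
  - by do 2 apply: measurableT_comp => //.
  - by apply: integral_ge0.
have intf : (mu \x lebesgue_cV n)%E.-integrable setT
  ((EFin \o f) \o @cons_cV R n).
  by rewrite fE.
have [i1 i2] := integral_cV_succ mf intf; split => //.
rewrite /Rintegral; transitivity (fine (\int[lebesgue_cV n.+1]_v
  (EFin \o f) v)%E); first by [].
rewrite i2; transitivity (fine (\int[mu \x lebesgue_cV n]_z
  (g z.1 * h z.2)%:E)%E).
  by congr fine; apply: eq_integral => z _;
    rewrite -[RHS]/((fun z => (g z.1 * h z.2)%:E) z) -fE.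
rewrite -integral12_prod_meas1// /fubini_F /=.
under eq_integral => x _.
  under eq_integral do rewrite EFinM.
  rewrite integralZl//.
  over.
have ihfin : (\int[lebesgue_cV n]_v (h v)%:E)%E \is a fin_num.
  exact: integrable_fin_num.
have igfin : (\int[mu]_x (g x)%:E)%E \is a fin_num by exact: integrable_fin_num.
rewrite -(fineK ihfin) integralZr//= fineM//.
Qed.

Lemma Complex_mul (a b c d : R) :
  Complex a b * Complex c d = Complex (a * c - b * d) (a * d + b * c).
Proof. by []. Qed.

Definition cintegrable n (f : 'cV[R]_n -> R[i]) :=
  (lebesgue_cV n).-integrable setT (EFin \o re_part f) /\
  (lebesgue_cV n).-integrable setT (EFin \o im_part f).

Definition cintegrable1 (f : R -> R[i]) :=
  mu.-integrable setT (EFin \o re_part f) /\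
    mu.-integrable setT (EFin \o im_part f).

Definition cintegral1 (f : R -> R[i]) : R[i] :=
  Complex (\int[mu]_x re_part f x) (\int[mu]_x im_part f x).

Definition ctensor n (h : 'I_n -> R -> R[i]) (v : 'cV[R]_n) : R[i] :=
  \prod_i h i (v i ord0).

Lemma ctensor_succ n (h : 'I_n.+1 -> R -> R[i]) v :
  ctensor h v = h ord0 (v ord0 ord0) *
    ctensor (fun i => h (lift ord0 i)) (\col_k v (lift ord0 k) ord0).
Proof.
by rewrite /ctensor big_ord_recl; congr (_ * _); apply: eq_bigr => i _;
  rewrite mxE.
Qed.

Lemma cintegral_ctensor n (h : 'I_n -> R -> R[i]) :
  (forall i, cintegrable1 (h i)) ->
  cintegrable (ctensor h) /\ cintegral (ctensor h) = \prod_i cintegral1 (h i).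
Proof.
elim: n h => [|n IH] h ih.
  (* On R^0 the measure is a Dirac mass, so the empty product 1 has integral 1. *)
  have h1 : ctensor h = cst 1 by apply/funext => v; rewrite /ctensor big_ord0.
  split.
    have fin (r : R) : (lebesgue_cV 0).-integrable setT (EFin \o cst r).
      apply: finite_measure_integrable_cst => //=.
    by split; rewrite h1; exact: fin.
  rewrite big_ord0 /cintegral h1 /re_part /im_part /= !Rintegral_cst//=.
  by rewrite indicT mulr1 mul0r.
have [[iR iI] E] := IH _ (fun i => ih (lift ord0 i)).
have [jR jI] := ih ord0.
(* The real and imaginary parts of a product of two complex factors involve four real tensor
   products. *)
have [i1 e1] := integral_cV_cons jR iR.
have [i2 e2] := integral_cV_cons jI iI.
have [i3 e3] := integral_cV_cons jR iI.
have [i4 e4] := integral_cV_cons jI iR.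
rewrite big_ord_recl -E /cintegral /cintegral1.
set t := ctensor (fun i => h (lift ord0 i)) in iR iI E i1 e1 i2 e2 i3 e3 i4 e4 *.
pose T (v : 'cV[R]_n.+1) : 'cV[R]_n := \col_k v (lift ord0 k) ord0.
have reE : re_part (ctensor h) = (fun v => re_part (h ord0)
  (v ord0 ord0) * re_part t (T v) -
     im_part (h ord0) (v ord0 ord0) * im_part t (T v)).
  apply/funext => v; rewrite /re_part ctensor_succ -/t -/(T v) /im_part.
  by case: (h ord0 _) (t (T v)) => [a b] [c d].
have imE : im_part (ctensor h) = (fun v => re_part (h ord0)
  (v ord0 ord0) * im_part t (T v) +
     im_part (h ord0) (v ord0 ord0) * re_part t (T v)).
  apply/funext => v; rewrite /im_part ctensor_succ -/t -/(T v) /re_part.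
  by case: (h ord0 _) (t (T v)) => [a b] [c d].
split.
  split; rewrite ?reE ?imE.
    have := integrableB measurableT i1 i2.
    by apply: eq_integrable => // v _ /=; rewrite EFinB.
  have := integrableD measurableT i3 i4.
  by apply: eq_integrable => // v _ /=; rewrite EFinD.
rewrite Complex_mul -e1 -e2 -e3 -e4 reE imE; congr Complex.
  by rewrite -RintegralB.
by rewrite -RintegralD.
Qed.

Definition tensor n (h : 'I_n -> R -> R) (v : 'cV[R]_n) : R :=
  \prod_i h i (v i ord0).

Lemma tensor_real_complex n (h : 'I_n -> R -> R) v :
  ctensor (fun i x => Complex (h i x) 0) v = Complex (tensor h v) 0.
Proof. by rewrite /ctensor /tensor -[RHS]/((\prod_i h i
  (v i ord0))%:C)%C rmorph_prod. Qed.

Lemma integral_tensor n (h : 'I_n -> R -> R) :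
  (forall i, mu.-integrable setT (EFin \o h i)) ->
  (lebesgue_cV n).-integrable setT (EFin \o tensor h) /\
  \int[lebesgue_cV n]_v tensor h v = \prod_i \int[mu]_x h i x.
Proof.
move=> ih.
have ih' i : cintegrable1 (fun x => Complex (h i x) 0).
  by split; [exact: ih|exact: integrable0].
have [[i1 _] e] := cintegral_ctensor ih'.
have reE : re_part (ctensor (fun i x => Complex (h i x) 0)) = tensor h.
  by apply/funext => v; rewrite /re_part tensor_real_complex.
rewrite reE in i1; split => //.
have : complex.Re (cintegral (ctensor (fun i x => Complex (h i x) 0))) =
       complex.Re (\prod_i cintegral1 (fun x => Complex (h i x) 0)) by rewrite e.
rewrite /cintegral /= reE => ->.
have -> : \prod_i cintegral1 (fun x => Complex (h i x) 0) =
   \prod_i ((\int[mu]_x h i x)%:C)%C.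
  apply: eq_bigr => i _; rewrite /cintegral1 /re_part /im_part /=; congr Complex.
  by rewrite /Rintegral integral0.
by rewrite -rmorph_prod.
Qed.

End integrals_of_tensor_products.

(** * A class of symbols and the Calderón-Zygmund condition *)

Section multiplier.
Context {R : realType} (m : nat).
Implicit Types (f g : 'cV[R]_m -> R) (x : 'cV[R]_m) (k : 'I_m).

Local Notation e k := (delta_mx k ord0 : 'cV[R]_m).

Lemma is_derive_line f x v (df : R) :
  is_derive (0 : R) 1 (fun h : R => f (h *: v + x)) df -> is_derive x v f df.
Proof.
move=> [d dE].
have E : (fun h : R => h^-1 *: (((fun h : R => f (h *: v + x)) \o shift 0)
  (h *: 1) - f (0 *: v + x))) =
    (fun h => h^-1 *: ((f \o shift x) (h *: v) - f x)).
  by apply/funext => h /=; rewrite addr0 scale0r add0r [h *: 1]mulr1.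
by constructor; move: d dE; rewrite /derivable /derive E.
Qed.

(** The inverse of the Japanese bracket: (1 + |x|^2)^(-1/2). *)
Definition japanese x : R := (Num.sqrt (1 + \sum_i x i ord0 ^+ 2))^-1.

Lemma sum_sqr_ge0 x : 0 <= \sum_i x i ord0 ^+ 2.
Proof. by apply: sumr_ge0 => i _; exact: sqr_ge0. Qed.

Lemma japanese_gt0 x : 0 < japanese x.
Proof. by rewrite invr_gt0 sqrtr_gt0 ltr_pwDl ?sum_sqr_ge0. Qed.

Lemma coord_japanese_le1 k x : `|x k ord0 * japanese x| <= 1.
Proof.
rewrite normrM (gtr0_norm (japanese_gt0 x)) ler_pdivrMr ?sqrtr_gt0 ?ltr_pwDl
  ?sum_sqr_ge0//.
rewrite mul1r -sqrtr_sqr ler_wsqrtr// (bigD1 k)//= addrCA lerDl addr_ge0//.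
by apply: sumr_ge0 => i _; exact: sqr_ge0.
Qed.

Lemma is_derive_coord k l x : is_derive x (e l) (fun x => x k ord0) ((k == l)%:R).
Proof.
apply: is_derive_line.
rewrite (_ : (fun _ => _) = (fun h => (k == l)%:R * h + x k ord0)); last first.
  by apply/funext => h; rewrite !mxE eqxx andbT mulrC.
have := is_deriveD (is_deriveM (is_derive_cst ((k == l)%:R : R) (0 : R) 1)
  (is_derive_id (0 : R) 1)) (is_derive_cst (x k ord0) (0 : R) 1).
by move=> /is_derive_eq; apply; rewrite addr0 scaler0 addr0 /cst [LHS]mulr1.
Qed.

Lemma is_derive_japanese l x :
  is_derive x (e l) japanese (- (x l ord0 * japanese x) *
    (japanese x * japanese x)).
Proof.
(* Along a coordinate line the expression under the root is a quadratic polynomial in h, so the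
   rules for one variable apply. *)
pose q h := 1 + \sum_i (h *: e l + x) i ord0 ^+ 2.
have q0 h : 0 < q h by rewrite ltr_pwDl ?sum_sqr_ge0.
have qE : q = fun h => h ^+ 2 + (2 * x l ord0) * h + (1 + \sum_i x i ord0 ^+ 2).
  apply/funext => h; rewrite /q (bigD1 l)//= [in RHS](bigD1 l)//=.
  rewrite !mxE !eqxx mulr1 (@eq_bigr _ _ _ _ _ _ _ (fun i => x i ord0 ^+ 2));
    first by ring.
  by move=> i /negPf il; rewrite !mxE il mulr0 add0r.
have dq : is_derive (0 : R) 1 q (2 * x l ord0).
  by rewrite qE; apply: is_derive_eq; rewrite /GRing.scale/=; ring.
have q00 : q 0 = 1 + \sum_i x i ord0 ^+ 2 by rewrite qE; ring.
have sq0 : Num.sqrt (q 0) != 0 by rewrite gt_eqF// sqrtr_gt0.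
have ds := @is_derive1_comp R Num.sqrt q 0 _ _ (is_derive1_sqrt (q0 0)) dq.
apply: is_derive_line.
have := @is_deriveV R (Num.sqrt \o q) 0 _ 1 sq0 ds.
move=> /is_derive_eq; apply.
rewrite /japanese -q00 /GRing.scale/=.
by field.
Qed.

(* Symbols of order [- d]: a partial derivative maps [symb d] to [symb d.+1],
  and a
   function in [symb d] is [O(japanese ^ d)]. *)
Inductive symb : nat -> ('cV[R]_m -> R) -> Prop :=
| symb_cst c : symb 0 (fun=> c)
| symb_japanese : symb 1 japanese
| symb_coord k : symb 0 (fun x => x k ord0 * japanese x)
| symbD d f g : symb d f -> symb d g -> symb d (f \+ g)
| symbM d1 d2 f g : symb d1 f -> symb d2 g -> symb (d1 + d2) (f \* g).

Lemma symb_eq d d' f : d = d' -> symb d f -> symb d' f.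
Proof. by move=> ->. Qed.

Lemma symb_is_derive d f k : symb d f ->
  exists2 g, symb d.+1 g & forall x, is_derive x (e k) f (g x).
Proof.
elim=> [c||l|d' f1 f2 _ [g1 s1 D1] _ [g2 s2 D2]|d1 d2 f1 f2 S1 [g1 s1 D1] S2
  [g2 s2 D2]].
(* The derivative 0 of a constant must have order 1, hence the factor [japanese]. *)
- exists ((fun=> 0) \* japanese).
    by apply: (@symb_eq (0 + 1)) => //; apply: symbM;
      [exact: symb_cst|exact: symb_japanese].
  by move=> x /=; rewrite mul0r; exact: is_derive_cst.
- exists (((fun=> -1) \* (fun x => x k ord0 * japanese x)) \*
    (japanese \* japanese)).
    apply: (@symb_eq ((0 + 0) + (1 + 1))) => //.
    by apply: symbM; apply: symbM; [exact: symb_cst|exact: symb_coord|exact: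
      symb_japanese|exact: symb_japanese].
  by move=> x /=; rewrite mulN1r; exact: is_derive_japanese.
- exists (((fun=> (l == k)%:R) \* japanese) \+
     ((fun x => x l ord0 * japanese x) \* (((fun=> -1) \*
       (fun x => x k ord0 * japanese x)) \* japanese))).
    apply: symbD.
      by apply: (@symb_eq (0 + 1)) => //; apply: symbM;
        [exact: symb_cst|exact: symb_japanese].
    apply: (@symb_eq (0 + ((0 + 0) + 1))) => //; apply: symbM;
      first exact: symb_coord.
    by apply: symbM; [apply: symbM; [exact: symb_cst|exact: symb_coord]|exact:
      symb_japanese].
  move=> x; have := is_deriveM (is_derive_coord l k x) (is_derive_japanese k x).
  by move=> /is_derive_eq; apply; rewrite /GRing.scale/=; ring.
- by exists (g1 \+ g2) => [|x]; [exact: symbD|exact: is_deriveD].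
- exists (f1 \* g2 \+ f2 \* g1) => [|x]; last exact: is_deriveM.
  apply: symbD; first by apply: (@symb_eq (d1 + d2.+1));
    [rewrite addnS|exact: symbM].
  by apply: (@symb_eq (d2 + d1.+1)); [rewrite addnS addnC|exact: symbM].
Qed.

Lemma symb_derivable d f k x : symb d f -> derivable f x (e k).
Proof. by move=> /(symb_is_derive k)[g _ /(_ x)[]]. Qed.

Lemma symb_partial d f k : symb d f -> symb d.+1 (partial k f).
Proof.
move=> /(symb_is_derive k)[g sg D]; rewrite (_ : partial k f = g)//.
by apply/funext => x; exact: derive_val.
Qed.

Lemma symb_partials d f s : symb d f -> symb (d + size s) (partials s f).
Proof.
move=> sf; elim: s => [|k s IH] /=; first by rewrite addn0.
by rewrite addnS; exact: symb_partial.
Qed.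

Lemma symb_bound d f : symb d f -> exists2 C, 0 <= C & forall x, `|f x| <= C *
  japanese x ^+ d.
Proof.
have u0 x d' : 0 <= japanese x ^+ d' by rewrite exprn_ge0// ltW// japanese_gt0.
elim=> [c||l|d' f1 f2 _ [C1 p1 H1] _ [C2 p2 H2]|d1 d2 f1 f2 _ [C1 p1 H1] _ [C2
  p2 H2]].
- by exists `|c| => // x; rewrite expr0 mulr1.
- by exists 1 => // x; rewrite expr1 mul1r ger0_norm// ltW// japanese_gt0.
- by exists 1 => // x; rewrite expr0 mul1r coord_japanese_le1.
- exists (C1 + C2) => [|x]; first exact: addr_ge0.
  by rewrite mulrDl (le_trans (ler_normD _ _))// lerD.
- exists (C1 * C2) => [|x]; first exact: mulr_ge0.
  by rewrite normrM exprD mulrACA ler_pM.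
Qed.

Lemma continuous_coord k : continuous (fun x => x k ord0).
Proof. exact: coord_continuous. Qed.

Lemma continuous_japanese : continuous japanese.
Proof.
move=> x.
have x0 : Num.sqrt (1 + \sum_i x i ord0 ^+ 2) != 0.
  by rewrite gt_eqF// sqrtr_gt0 ltr_pwDl ?sum_sqr_ge0.
have cS : continuous (fun x => \sum_i x i ord0 ^+ 2).
  apply: (@continuous_big R 'I_m +%R) => [|i _ y]; first exact: add_continuous.
  exact: (@continuous_comp _ _ _ (fun x => x i ord0) (fun y => y ^+ 2) y
    (@continuous_coord i y) (@exprn_continuous R 2 _)).
have c1 : {for x, continuous (fun x => 1 + \sum_i x i ord0 ^+ 2)}.
  by apply: continuousD; [exact: cst_continuous|exact: cS].
pose s x := Num.sqrt (1 + \sum_i x i ord0 ^+ 2).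
have cs : {for x, continuous s} by apply: (continuous_comp c1);
  exact: sqrt_continuous.
exact: (@continuousV _ _ s x x0 cs).
Qed.

Lemma symb_continuous d f : symb d f -> continuous f.
Proof.
elim=> [c||l|d' f1 f2 _ H1 _ H2|d1 d2 f1 f2 _ H1 _ H2] x.
- exact: cst_continuous.
- exact: continuous_japanese.
- by apply: continuousM; [exact: continuous_coord|exact: continuous_japanese].
- by apply: continuousD; [exact: H1|exact: H2].
- by apply: continuousM; [exact: H1|exact: H2].
Qed.

Lemma symb_Ck_on d f n (U : set 'cV[R]_m) : symb d f -> Ck_on n U f.
Proof.
move=> sf s; have ss := symb_partials s sf.
split=> _ x _; first exact: (symb_continuous ss).
by move=> i; exact: symb_derivable ss.
Qed.

(** The constant must not depend on the word. The last letter of a word acts first, so the induction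
    hypothesis is applied to each [partial k f], and the finitely many constants are added. *)
Lemma symb_partials_bound d f n : symb d f ->
  exists2 C, 0 <= C & forall s, size s = n ->
    forall x, `|partials s f x| <= C * japanese x ^+ (d + n).
Proof.
elim: n d f => [|n IH] d f sf.
  have [C C0 HC] := symb_bound sf.
  by exists C => // s /size0nil -> x /=; rewrite addn0.
have /choice[C HC] : forall k, exists C, 0 <= C /\ forall s, size s = n ->
    forall x, `|partials s (partial k f) x| <= C * japanese x ^+ (d + n.+1).
  move=> k; have [C C0 HC] := IH _ _ (symb_partial k sf).
  by exists C; split => // s sn x; rewrite addnS -addSn; exact: HC.
exists (\sum_k C k); first by apply: sumr_ge0 => k _; case: (HC k).
move=> s; case/lastP: s => [//|s k]; rewrite size_rcons => -[sn] x.
rewrite /partials -cats1 foldr_cat /=.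
have [_ /(_ s sn x) h] := HC k; apply: le_trans h _.
apply: ler_wpM2r; first by rewrite exprn_ge0// ltW// japanese_gt0.
by rewrite (bigD1 k)//= lerDl; apply: sumr_ge0 => i _; case: (HC i).
Qed.

Lemma symb_partials_bound_le d f n : symb d f ->
  exists2 C, 0 <= C & forall s, (size s <= n)%N ->
    forall x, `|partials s f x| <= C * japanese x ^+ (d + size s).
Proof.
move=> sf; have /choice[C HC] : forall n, exists C, 0 <= C /\
  forall s, size s = n ->
    forall x, `|partials s f x| <= C * japanese x ^+ (d + n).
  by move=> n'; have [C C0 HC] := symb_partials_bound n' sf; exists C.
exists (\sum_(i < n.+1) C i); first by apply: sumr_ge0 => k _; case: (HC k).
move=> s sn x; have [_ /(_ s erefl x) h] := HC (size s); apply: le_trans h _.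
apply: ler_wpM2r; first by rewrite exprn_ge0// ltW// japanese_gt0.
have := ltnS (size s) n; rewrite sn => sn1.
rewrite (bigD1 (Ordinal sn1))//= lerDl; apply: sumr_ge0 => i _.
by case: (HC i).
Qed.

Lemma partials_scale d f s (c : R) : symb d f ->
  partials s (fun x => c * f x) = (fun x => c * partials s f x).
Proof.
move=> sf; elim: s => [//|k s IH] /=; rewrite IH; apply/funext => x.
have [g _ /(_ x) D] := symb_is_derive k (symb_partials s sf).
have D' := is_deriveM (is_derive_cst c x (e k)) D.
have -> : partial k (partials s f) x = g x by exact: derive_val.
have -> : partial k (fun x => c * partials s f x) x =
  c *: g x + partials s f x *: 0.
  exact: derive_val.
by rewrite scaler0 addr0.
Qed.

Lemma size_mpartial (beta : {ffun 'I_m -> nat}) :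
  size (flatten [seq nseq (beta i) i | i <- enum 'I_m]) = mlength beta.
Proof.
rewrite size_flatten /shape -map_comp sumnE big_map big_enum.
by apply: eq_bigr => i _ /=; rewrite size_nseq.
Qed.

Lemma japanese_le_enormV x : x != 0 -> japanese x <= (enorm x)^-1.
Proof.
move=> x0; rewrite lef_pV2 ?posrE ?sqrtr_gt0 ?ltr_pwDl ?sum_sqr_ge0//.
  by rewrite ler_wsqrtr// lerDr.
rewrite lt_neqAle sum_sqr_ge0 andbT eq_sym; apply: contra x0.
rewrite psumr_eq0; last by move=> i _; exact: sqr_ge0.
move=> /allP h; apply/eqP/matrixP => i j; rewrite mxE (ord1 j).
by apply/eqP; rewrite -sqrf_eq0; apply: h; rewrite mem_index_enum.
Qed.

Lemma partials_cst0 (s : seq 'I_m) : partials s (fun=> 0 : R) = fun=> 0.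
Proof.
elim: s => [//|k s IH] /=; rewrite IH.
by apply/funext => x; rewrite /partial derive_cst.
Qed.

(** A derivative of order b is O([japanese] ^ b), and [japanese x] <= 1/|x|; dividing by a constant
    common to all orders up to [n] normalises the bounds. The constant [C + 1] is used because [C]
    may be 0. *)
Lemma cz_multiplier_symb f n : symb 0 f ->
  exists2 c : R, 0 < c & cz_multiplier n (fun x => Complex (c * f x) 0).
Proof.
move=> sf; have [C C0 HC] := symb_partials_bound_le n sf.
have C1 : 0 < C + 1 by lra.
exists (C + 1)^-1; first by rewrite invr_gt0.
split.
- by apply: (@symb_Ck_on (0 + 0)); apply: (symbM (symb_cst _) sf).
- by apply: (@symb_Ck_on 0); exact: symb_cst.
move=> beta x bn x0.
have -> : cmpartial beta (fun x => Complex ((C + 1)^-1 * f x) 0) x =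
    Complex ((C + 1)^-1 * mpartial beta f x) 0.
  rewrite /cmpartial /mpartial.
  by rewrite /re_part /im_part /= (partials_scale _ _ sf) partials_cst0.
rewrite /= expr0n addr0 sqrtr_sqr normrM ger0_norm ?invr_ge0 ?(ltW C1)//.
rewrite ler_pdivrMl//.
have := HC (flatten [seq nseq (beta i) i | i <- enum 'I_m]).
rewrite size_mpartial => /(_ bn x) h; apply: le_trans h _.
rewrite add0n; apply: ler_pM => //.
- by rewrite exprn_ge0// ltW// japanese_gt0.
- by rewrite lerDl.
- rewrite -exprVn lerXn2r ?nnegrE ?japanese_le_enormV//.
    exact/ltW/japanese_gt0.
  by rewrite invr_ge0 sqrtr_ge0.
Qed.

End multiplier.

(** * Tensor products as smooth compactly supported test functions *)

Section smoothness_of_tensor_products.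
Context {R : realType} (n : nat).
Implicit Types (f : 'I_n -> R -> R) (x : 'cV[R]_n).

Lemma continuous_tensor f : (forall i, continuous (f i)) -> continuous (tensor f).
Proof.
move=> cf; apply: (@continuous_big R 'I_n *%R) => [|i _ x];
  first exact: mul_continuous.
exact: (@continuous_comp _ _ _ (fun x : 'cV[R]_n => x i ord0) (f i) x
    (@coord_continuous _ _ _ i ord0 x) (cf i _)).
Qed.

Lemma is_derive_tensor f k x : (forall i, smooth1 (f i)) ->
  is_derive x (delta_mx k ord0) (tensor f)
    (tensor (fun i => if i == k then derive1 (f i) else f i) x).
Proof.
move=> sf; apply: is_derive_line.
pose c := \prod_(i | i != k) f i (x i ord0).
rewrite (_ : (fun h => _) = (fun h => f k (1 * h + x k ord0)) \* cst c);
  last first.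
  apply/funext => h; rewrite /tensor (bigD1 k)//= !mxE !eqxx mulr1 mul1r;
    congr (_ * _).
  by apply: eq_bigr => i /negPf ik; rewrite !mxE ik mulr0 add0r.
have D := is_derive_comp_affine (smooth1_is_derive (1 * 0 + x k ord0) (sf k)).
have := is_deriveM D (is_derive_cst c (0 : R) 1).
move=> /is_derive_eq; apply.
rewrite /tensor (bigD1 k)//= eqxx scaler0 add0r mulr1 mulr0 add0r [RHS]mulrC.
by congr (_ * _); apply: eq_bigr => i /negPf ->.
Qed.

Lemma partials_tensor f s : (forall i, smooth1 (f i)) ->
  partials s (tensor f) = tensor (fun i => derive1n (count_mem i s) (f i)).
Proof.
move=> sf; elim: s => [//|k s IH] /=; rewrite IH; apply/funext => x.
have sf' i : smooth1 (derive1n (count_mem i s) (f i)) by exact: smooth1_derive1n.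
have := is_derive_tensor k x sf' => D.
have -> : partial k (tensor (fun i => derive1n (count_mem i s) (f i))) x =
  tensor (fun i => if i == k then derive1 (derive1n (count_mem i s) (f i)) else
    derive1n (count_mem i s) (f i)) x by exact: derive_val.
apply: eq_bigr => i _; rewrite [k == i]eq_sym; case: (i == k) => //=.
Qed.

Lemma smooth_tensor f : (forall i, smooth1 (f i)) -> smooth (tensor f).
Proof.
move=> sf k s; rewrite partials_tensor//.
have sf' i : smooth1 (derive1n (count_mem i s) (f i)) by exact: smooth1_derive1n.
split=> _ x _; first by apply: continuous_tensor => i; exact: smooth1_continuous.
by move=> i; case: (is_derive_tensor i x sf').
Qed.

(** The box is the transpose of a box of row vectors, which is compact as a product of segments. *)
Lemma compact_box (L : R) : compact [set x : 'cV[R]_n | forall i, `[- L,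
  L]%classic (x i ord0)].
Proof.
have cr : compact [set v : 'rV[R]_n | forall i, `[- L, L]%classic (v ord0 i)].
  by apply: (@rV_compact R n (fun=> `[- L, L]%classic)) => i;
    exact: segment_compact.
have ct : continuous (fun v : 'rV[R]_n => v^T : 'cV[R]_n).
  move=> v A [B Bv BA].
  exists (fun i j => B j i); first by move=> i j; have := Bv j i; rewrite mxE.
  by move=> w Bw; apply: BA => i j; rewrite mxE; exact: Bw.
rewrite (_ : [set x | _] = (fun v : 'rV[R]_n => v^T : 'cV[R]_n) @` [set v :
  'rV[R]_n | forall i, `[- L, L]%classic (v ord0 i)]).
  by apply: continuous_compact => //; exact: continuous_subspaceT.
apply/seteqP; split => [x Lx|_ [v Lv <-] i]; last by rewrite mxE; exact: Lv.
by exists x^T; [move=> i; rewrite mxE; exact: Lx|rewrite trmxK].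
Qed.

Lemma compactly_supported_tensor f (L : R) :
  (forall i, vanishes L (f i)) -> compactly_supported (tensor f).
Proof.
move=> fL; have cb := @compact_box L.
apply: (subclosed_compact _ cb); first exact: closed_closure.
have /closure_id -> : closed [set x : 'cV[R]_n | forall i, `[- L, L]%classic
  (x i ord0)].
  by apply: compact_closed => //; exact: norm_hausdorff.
apply: closureS => x /= fx i; apply/negPn/negP => xi.
by move/eqP: fx; apply; rewrite /tensor (bigD1 i)//= (vanishes_notin
  (fL i))// mul0r.
Qed.

End smoothness_of_tensor_products.

(** * The form evaluated on tensor products, for Pi = (I I) *)

Section fourier_transforms_of_tensor_products.
Context {R : realType}.
Local Notation mu := (@lebesgue_measure R).

Definition ft (f : R -> R) (y : R) : R[i] := Complex (cosT f y) (- sinT f y).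

Lemma expiD (a b : R) : expi (a + b) = expi a * expi b.
Proof. by rewrite /expi cosD sinD /=; congr Complex; rewrite addrC. Qed.

Lemma expi_sum n (a : 'I_n -> R) : expi (\sum_i a i) = \prod_i expi (a i).
Proof.
have expi0 : expi (0 : R) = 1 by rewrite /expi cos0 sin0.
exact: (big_morph (@expi R) expiD expi0).
Qed.

Lemma fourier_tensor (L : R) n (h : 'I_n -> R -> R) (xi : 'cV[R]_n) :
  (forall i, continuous (h i)) -> (forall i, vanishes L (h i)) ->
  fourier (tensor h) xi = \prod_i ft (h i) (xi i ord0).
Proof.
move=> ch hL.
pose g (i : 'I_n) t := Complex (h i t * cos (2 * pi * (t * xi i ord0)))
  (- (h i t * sin (2 * pi * (t * xi i ord0)))).
have gE : (fun x : 'cV[R]_n => Complex (tensor h x) 0 *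
    expi (- (2 * pi * (x^T *m xi) ord0 ord0))) = ctensor g.
  apply/funext => x.
  have -> : - (2 * pi * (x^T *m xi) ord0 ord0) =
      \sum_i - (2 * pi * (x i ord0 * xi i ord0)).
    by rewrite mxE mulr_sumr -sumrN; apply: eq_bigr => i _; rewrite mxE.
  rewrite expi_sum -tensor_real_complex -big_split /=; apply: eq_bigr => i _.
  rewrite /expi cosN sinN /g Complex_mul !mul0r subr0 addr0 mulrN.
  by [].
have gint i : cintegrable1 (g i).
  split; first exact: integrable_cos_phase (ch i) (hL i) _.
  have := integrableN (integrable_sin_phase (ch i) (hL i) (xi i ord0)).
  by apply: eq_integrable.
rewrite /fourier gE (cintegral_ctensor gint).2; apply: eq_bigr => i _.
rewrite /cintegral1 /ft; congr Complex.
rewrite /sinT -mulN1r -RintegralZl//;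
  last exact: integrable_sin_phase (ch i) (hL i) _.
by apply: eq_Rintegral => t _; rewrite /im_part /= mulN1r.
Qed.

(** The i-th entry of Pi_j x is x_i^b with b = j(i), so exchanging the two products lets each of the
    2m coordinates collect the factors of one face of the cube. *)
Lemma prod_tensor_cube m (f : cube m -> 'I_m -> R -> R) (x : 'cV[R]_(m + m)) :
  \prod_(j : cube m) tensor (f j) (coord_proj R j *m x) =
  tensor (fun k : 'I_(m + m) => match fintype.split k with
    | inl i => fun t => \prod_(j : cube m | ~~ j i) f j i t
    | inr i => fun t => \prod_(j : cube m | j i) f j i t end) x.
Proof.
rewrite /tensor big_split_ord /= -big_split /= exchange_big /=;
  apply: eq_bigr => i _.
rewrite (bigID (fun j : cube m => j i)) /= mulrC.
have E (j : cube m) : (coord_proj R j *m x) i ord0 = x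
  (if j i then rshift m i else lshift m i) ord0.
  rewrite mxE (bigD1 (if j i then rshift m i else lshift m i))//= mxE eqxx mul1r.
  by rewrite big1 ?addr0// => k /negPf ki; rewrite mxE ki mul0r.
congr (_ * _).
  rewrite (unsplitK (inl i : 'I_m + 'I_m)%type).
  by apply: eq_bigr => j /negPf ji; rewrite E ji.
rewrite (unsplitK (inr i : 'I_m + 'I_m)%type).
by apply: eq_bigr => j ji; rewrite E ji.
Qed.

Definition twin_mx m : 'M[R]_(m, m + m) := row_mx 1%:M 1%:M.

Lemma coord_proj_twin_mx m (j : cube m) : coord_proj R j *m (twin_mx m)^T = 1%:M.
Proof.
apply/matrixP => i k; rewrite !mxE (bigD1
  (if j i then rshift m i else lshift m i))//=.
rewrite big1 => [|l /negPf li]; last by rewrite mxE li mul0r.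
rewrite addr0 !mxE eqxx mul1r.
by case: (j i); [rewrite (unsplitK (inr i : 'I_m + 'I_m)%type)|rewrite
  (unsplitK (inl i : 'I_m + 'I_m)%type)]; rewrite mxE eq_sym.
Qed.

Lemma Delta_regular1 m (Delta : R) : 1 < Delta ->
  Delta_regular Delta (1%:M : 'M[R]_m).
Proof.
move=> D1; split; first by rewrite det1 oner_neq0.
rewrite det1 normr1 invr1 ge_max (ltW D1) andbT.
apply: le_trans (ltW D1); rewrite /opnorm; apply: ge_sup.
  exists (enorm (1%:M *m (0 : 'cV[R]_m))); exists 0 => //=.
  by rewrite /enorm big1 ?sqrtr0// => i _; rewrite mxE expr0n.
by move=> _ [v /= v1 <-]; rewrite mul1mx.
Qed.

(** For Pi = (I I) the vector Pi^T eta is eta repeated twice, so the transforms belonging to x_i^0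
    and x_i^1 are both taken at -eta_i. *)
Lemma pv_integral_tensor (L : R) m (f : cube m -> 'I_m -> R ->
  R) (Khat : 'cV[R]_m -> R[i]) :
  (forall i, continuous (fun t => \prod_(j : cube m | ~~ j i) f j i t)) ->
  (forall i, continuous (fun t => \prod_(j : cube m | j i) f j i t)) ->
  (forall i, vanishes L (fun t => \prod_(j : cube m | ~~ j i) f j i t)) ->
  (forall i, vanishes L (fun t => \prod_(j : cube m | j i) f j i t)) ->
  pv_integral (twin_mx m) Khat (fun x => \prod_(j : cube m) tensor (f j)
    (coord_proj R j *m x)) =
  cintegral (fun eta => ctensor (fun i y =>
     ft (fun t => \prod_(j : cube m | ~~ j i) f j i t) (- y) *
     ft (fun t => \prod_(j : cube m | j i) f j i t) (- y)) eta * Khat eta).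
Proof.
move=> c0 c1 v0 v1; rewrite /pv_integral; congr cintegral; apply/funext => eta.
congr (_ * _).
rewrite (_ : (fun x => _) = tensor (fun k : 'I_(m +
  m) => match fintype.split k with
    | inl i => fun t => \prod_(j : cube m | ~~ j i) f j i t
    | inr i => fun t => \prod_(j : cube m | j i) f j i t end)); last first.
  by apply/funext => x; exact: prod_tensor_cube.
rewrite (@fourier_tensor L); last 2 first.
- by move=> k; case: (fintype.split k) => i; [exact: c0|exact: c1].
- by move=> k; case: (fintype.split k) => i; [exact: v0|exact: v1].
rewrite big_split_ord /= -big_split /=; apply: eq_bigr => i _.
rewrite (unsplitK (inl i : 'I_m + 'I_m)%type) (unsplitK
  (inr i : 'I_m + 'I_m)%type).
rewrite /twin_mx tr_row_mx !trmx1 mul_col_mx !mul1mx.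
by rewrite !mxE (unsplitK (inl i : 'I_m + 'I_m)%type) (unsplitK
  (inr i : 'I_m + 'I_m)%type).
Qed.

(** Flipping the bit at [i] is an involution exchanging the two opposite faces, which together have
    2^m elements. *)
Lemma card_cube_face m (i : 'I_m) (b : bool) :
  #|[pred j : cube m | j i == b]| = (2 ^ (m - 1))%N.
Proof.
pose flip (j : cube m) : cube m := [ffun k => if k == i then ~~ j k else j k].
have flipK : involutive flip.
  by move=> j; apply/ffunP => k; rewrite !ffunE; case: eqP => // _; rewrite negbK.
have E b' : #|[pred j : cube m | j i == b']| =
  #|[pred j : cube m | j i == ~~ b']|.
  rewrite -(fintype.card_image (can_inj flipK)); apply: eq_card => j.
  apply/fintype.imageP/idP => [[k /= ki ->]|/= ji].
    by move: ki; rewrite !inE ffunE eqxx => /eqP ->.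
  by exists (flip j); rewrite ?flipK// inE ffunE eqxx (eqP ji) negbK.
have : (#|[pred j : cube m | j i == b]| + #|[pred j : cube m | j i == ~~ b]| =
  2 ^ m)%N.
  rewrite -[RHS]/(2 ^ m)%N -[in RHS](card_ord m) -card_bool -card_ffun.
  rewrite -(cardC [pred j : cube m | j i == b]); congr addn.
  by apply: eq_card => j; rewrite !inE; case: (j i) b => -[].
case: m i flip flipK E => [[]//|m] i _ _ E; rewrite -E expnS subn1 /=.
by rewrite addnn -mul2n => /eqP; rewrite eqn_pmul2l// => /eqP.
Qed.

End fourier_transforms_of_tensor_products.

(** * The one-variable functions of the counterexample *)

Section example_functions.
Context {R : realType}.
Local Notation mu := (@lebesgue_measure R).

Lemma smooth1_dilation (f : R -> R) (a : R) : smooth1 f ->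
  smooth1 (fun x => f (a * x)).
Proof.
move=> sf n; have := Ck1_comp_affine a 0 (sf n).
by under eq_fun do rewrite addr0.
Qed.

Lemma smooth1_dilation_translation (f : R -> R) (a c : R) :
  smooth1 f -> smooth1 (fun x => f (a * (x + c))).
Proof.
move=> sf n; have := Ck1_comp_affine a (a * c) (sf n).
by under eq_fun do rewrite -mulrDr.
Qed.

Lemma smooth1D (f g : R -> R) : smooth1 f -> smooth1 g -> smooth1 (f \+ g).
Proof. by move=> sf sg n; exact: Ck1D. Qed.

Lemma smooth1Z (c : R) (f : R -> R) : smooth1 f -> smooth1 (fun x => c * f x).
Proof. by move=> sf n; apply: (Ck1M (Ck1_cst n c)). Qed.

Lemma is_derive_dilation_translation (f f' : R -> R) (a c x : R) :
  (forall x : R, is_derive x 1 f (f' x)) ->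
  is_derive x 1 (fun x => f (a * (x + c))) (a * f' (a * (x + c))).
Proof.
move=> ff'; have := is_derive_comp_affine (ff' (a * x + a * c)).
by under eq_fun do rewrite -mulrDr; rewrite -mulrDr mulrC.
Qed.

Variable M : nat.
Hypothesis M0 : (0 < M)%N.

(** [M] will be the size 2^(m-1) of a face of the cube, so that a product of equal bumps over a face
    is [psi]. *)
Definition psi (x : R) : R := bump x ^+ M.

Lemma smooth1_psi : smooth1 psi.
Proof. by move=> n; apply: Ck1X; exact: smooth1_bump. Qed.

Lemma continuous_psi : continuous psi.
Proof. exact: smooth1_continuous smooth1_psi. Qed.

Lemma psi_ge0 x : 0 <= psi x. Proof. by rewrite exprn_ge0 ?bump_ge0. Qed.

Lemma psiN x : psi (- x) = psi x. Proof. by rewrite /psi bumpN. Qed.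

Lemma vanishes_psi : vanishes 8^-1 psi.
Proof. by move=> x x8; rewrite /psi bump_out// expr0n gtn_eqF. Qed.

Definition Psi : R -> R := primitive psi.
Definition psi_mass : R := \int[mu]_x psi x.

Lemma is_derive_Psi (x : R) : is_derive x 1 Psi (psi x).
Proof. exact: is_derive_primitive continuous_psi vanishes_psi x. Qed.

Lemma smooth1_Psi : smooth1 Psi.
Proof. exact: smooth1_primitive is_derive_Psi smooth1_psi. Qed.

Lemma Psi_ge0 x : 0 <= Psi x.
Proof. exact: primitive_ge0 psi_ge0 x. Qed.

Lemma Psi_le x : Psi x <= psi_mass.
Proof. exact: primitive_le continuous_psi vanishes_psi psi_ge0 x. Qed.

Lemma Psi_left x : x <= - 8^-1 -> Psi x = 0.
Proof. exact: primitive_left vanishes_psi x. Qed.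

Lemma Psi_right x : 8^-1 <= x -> Psi x = psi_mass.
Proof. exact: primitive_right vanishes_psi x. Qed.

(** If the mass were 0, the primitive [Psi], which lies between 0 and the mass, would vanish
    identically, and so would its derivative [psi]; but [bump 0] is positive. *)
Lemma psi_mass_gt0 : 0 < psi_mass.
Proof.
rewrite lt_neqAle (le_trans (Psi_ge0 0) (Psi_le 0)) andbT eq_sym.
apply/negP => /eqP J0.
have Psi0 : Psi = cst 0.
  by apply/funext => x; apply/eqP; rewrite eq_le /cst -{1}J0 Psi_le Psi_ge0.
have D := is_derive_Psi 0; have : 'D_1 Psi (0 : R) = psi 0 by exact: derive_val.
rewrite Psi0 derive_cst => /esym/eqP.
by rewrite expf_eq0 gt_eqF ?andbF// bump0.
Qed.

Section dilation.
Variable N : R.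
Hypothesis N1 : 1 <= N.

Definition psi_dil x : R := psi (N * x).

Let N0 : 0 < N. Proof. by apply: lt_le_trans N1. Qed.

Lemma smooth1_psi_dil : smooth1 psi_dil.
Proof. exact: smooth1_dilation smooth1_psi. Qed.

Lemma continuous_psi_dil : continuous psi_dil.
Proof. exact: smooth1_continuous smooth1_psi_dil. Qed.

Lemma psi_dil_ge0 x : 0 <= psi_dil x. Proof. exact: psi_ge0. Qed.

Lemma psi_dil_out x : (8 * N)^-1 <= `|x| -> psi_dil x = 0.
Proof.
move=> x8; apply: vanishes_psi; rewrite normrM
  (gtr0_norm N0) mulrC -ler_pdivrMr//.
by rewrite -invfM mulrC; move: x8; rewrite mulrC.
Qed.

Lemma vanishes_psi_dil : vanishes 1 psi_dil.
Proof.
move=> x x1; apply: psi_dil_out; apply: le_trans x1.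
by rewrite invf_le1 ?mulr_gt0//; have := N1; lra.
Qed.

Lemma integral_psi_dil : \int[mu]_x psi_dil x = psi_mass / N.
Proof.
have D (x : R) : is_derive x 1 (fun x => N^-1 * Psi (N * (x + 0))) (psi_dil x).
  have D0 := is_derive_dilation_translation N 0 x is_derive_Psi.
  have := is_deriveM (is_derive_cst (N^-1) x 1) D0.
  move=> /is_derive_eq; apply; rewrite scaler0 addr0 /GRing.scale/= mulKf
    ?gt_eqF//.
  by rewrite addr0.
rewrite (Rintegral_vanishes ltr01 continuous_psi_dil vanishes_psi_dil D).
have N2 := N1.
rewrite !addr0 mulr1 mulrN1 Psi_right; last by lra.
by rewrite Psi_left ?mulr0 ?subr0 1?mulrC//; lra.
Qed.

(** Since cos(2t) >= 0, the square of cos t is at least 1/2, and cos t <= 1 makes cos t at least its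
    square. *)
Lemma cos_ge_half (t : R) : `|t| <= pi / 4 -> 2^-1 <= cos t.
Proof.
rewrite ler_norml => /andP[t1 t2]; have p0 := pi_gt0 R.
have c0 : 0 <= cos t by apply: cos_ge0_pihalf; apply/andP; split; lra.
have : 0 <= cos (t *+ 2) by apply: cos_ge0_pihalf; rewrite [t *+ 2]mulr2n;
  apply/andP; split; lra.
rewrite cos_mulr2n [_ ^+ 2 *+ 2]mulr2n expr2; have := cos_le1 t; nra.
Qed.

(** On the support |x| <= 1/(8N), so for these frequencies the phase stays within pi/4 and the
    cosine costs at most a factor 2 against the integral of [psi_dil]. *)
Lemma cosT_psi_dil_ge y : `|y| <= N -> psi_mass / N / 2 <= cosT psi_dil y.
Proof.
move=> yN; rewrite -integral_psi_dil /cosT -RintegralZr//; last first.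
  exact: integrable_vanishes continuous_psi_dil vanishes_psi_dil.
apply: le_Rintegral => //.
- have := integrableZr measurableT 2^-1
    (integrable_vanishes continuous_psi_dil vanishes_psi_dil).
  by apply: eq_integrable => // x _ /=; rewrite EFinM.
- exact: integrable_cos_phase continuous_psi_dil vanishes_psi_dil y.
- move=> x _; have [x8|x8] := leP (8 * N)^-1 `|x|.
    by rewrite psi_dil_out// !mul0r.
  apply: ler_wpM2l; first exact: psi_dil_ge0.
  apply: cos_ge_half; have p0 := pi_gt0 R.
  have xy : `|x| * `|y| <= 8^-1.
    have -> : 8^-1 = (8 * N)^-1 * N :> R by rewrite invfM mulfVK ?gt_eqF.
    by apply: ler_pM => //; exact: ltW.
  rewrite !normrM (ger0_norm (ltW p0)) ger0_norm//.
  by have := mulr_ge0 (normr_ge0 x) (normr_ge0 y); nra.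
Qed.

Lemma sinT_psi_dil y : sinT psi_dil y = 0.
Proof.
apply: (sinT_even continuous_psi_dil vanishes_psi_dil ltr01) => x.
by rewrite /psi_dil mulrN psiN.
Qed.

(* Up to the factor [psi_mass], the function [1_(-1,0) - 1_(0,1)] smoothed at
  scale
   [1 / N].  As a second difference of [Psi] it satisfies [sinT_step], where the
   factor [cos - 1] has constant sign. *)
Definition step x : R :=
  Psi (N * (x + 1)) + (-2 * Psi (N * (x + 0)) + Psi (N * (x + -1))).

Definition dstep x : R :=
  N * psi (N * (x + 1)) + (-2 * (N * psi (N * (x + 0))) + N * psi (N * (x + -1))).

Lemma smooth1_step : smooth1 step.
Proof.
apply: smooth1D; first exact/smooth1_dilation_translation/smooth1_Psi.
apply: smooth1D; last exact/smooth1_dilation_translation/smooth1_Psi.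
exact/smooth1Z/smooth1_dilation_translation/smooth1_Psi.
Qed.

Lemma is_derive_step (x : R) : is_derive x 1 step (dstep x).
Proof.
have D c := is_derive_dilation_translation N c x is_derive_Psi.
have := is_deriveD (D 1) (is_deriveD (is_deriveM (is_derive_cst (-2 : R) x 1)
  (D 0)) (D (-1))).
by move=> /is_derive_eq; apply; rewrite scaler0 addr0 /dstep /GRing.scale/=.
Qed.

Lemma vanishes_step : vanishes 2 step.
Proof.
have N2 := N1.
move=> x; rewrite real_ler_normr ?num_real// /step => /orP[x2|x2].
  by rewrite !Psi_right; [ring|nra..].
by rewrite !Psi_left; [ring|nra..].
Qed.

Lemma vanishes_dstep : vanishes 2 dstep.
Proof.
have N2 := N1.
move=> x x2; rewrite /dstep -!/(psi_dil _).
have h1 := ler_normB (x + 1) 1; have h2 := ler_normB (x + -1) (-1).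
rewrite addrK in h1; rewrite addrK normrN in h2; rewrite normr1 in h1 h2.
by rewrite addr0 !vanishes_psi_dil ?mulr0 ?addr0//; lra.
Qed.

Lemma step_le x : `|step x| <= 4 * psi_mass.
Proof.
rewrite /step; set a := Psi _; set b := Psi _; set c := Psi _.
have := (Psi_ge0 (N * (x + 1)), Psi_ge0 (N * (x + 0)), Psi_ge0 (N * (x + -1)),
  (Psi_le (N * (x + 1)), Psi_le (N * (x + 0)), Psi_le (N * (x + -1)))).
rewrite -/a -/b -/c => -[[[? ?] ?] [[? ?] ?]].
by rewrite ler_norml; apply/andP; split; lra.
Qed.

Lemma continuous_dstep : continuous dstep.
Proof.
have c d : smooth1 (fun x => N * psi (N * (x + d))).
  exact/smooth1Z/smooth1_dilation_translation/smooth1_psi.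
apply: smooth1_continuous; apply: smooth1D => //; apply: smooth1D => //.
exact: smooth1Z.
Qed.

(** The derivative [dstep] is N times a second difference of the even function [psi_dil], so its
    cosine transform is N (2 cos(2 pi y) - 2) times that of [psi_dil]; it also equals 2 pi y times
    the left-hand transform. The factor [y] stays on the left, where the multiplier supplies it, so
    that y = 0 needs no separate treatment. *)
Lemma sinT_step y : y * sinT step y = N / pi * (cos
  (2 * pi * y) - 1) * cosT psi_dil y.
Proof.
have p0 := pi_gt0 R.
have cd d : continuous (fun x => psi_dil (x + d)).
  exact/smooth1_continuous/smooth1_dilation_translation/smooth1_psi.
have vd d : `|d| <= 1 -> vanishes 2 (fun x => psi_dil (x + d)).
  move=> d1 x x2; apply: vanishes_psi_dil; have := ler_normB (x + d) d;
    rewrite addrK; lra.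
have T d : `|d| <= 1 -> cosT (fun x => psi_dil (x + d)) y = cos (2 * pi *
  (d * y)) * cosT psi_dil y.
  move=> d1; rewrite (cosT_translation continuous_psi_dil vanishes_psi_dil ltr01).
  by rewrite sinT_psi_dil mulr0 addr0.
have E : cosT dstep y = N * ((cosT (fun x => psi_dil
  (x + 1)) y - 2 * cosT psi_dil y) +
    cosT (fun x => psi_dil (x + -1)) y).
  have i0 := integrable_cos_phase continuous_psi_dil vanishes_psi_dil y.
  have i1 : mu.-integrable setT (EFin \o (fun x => psi_dil (x + 1) * cos
    (2 * pi * (x * y)))).
    by apply: (integrable_cos_phase (@cd 1) (vd 1 _)); rewrite normr1.
  have i2 : mu.-integrable setT (EFin \o (fun x => psi_dil (x + -1) * cos
    (2 * pi * (x * y)))).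
    by apply: (integrable_cos_phase (@cd (-1)) (vd (-1) _));
      rewrite normrN normr1.
  have i3 : mu.-integrable setT (EFin \o (fun x => 2 * (psi_dil x * cos
    (2 * pi * (x * y))))).
    have := integrableZl measurableT 2 i0.
    by apply: eq_integrable => // x _ /=; rewrite EFinM.
  have i4 : mu.-integrable setT (EFin \o (fun x => psi_dil (x + 1) * cos
    (2 * pi * (x * y)) -
       2 * (psi_dil x * cos (2 * pi * (x * y))))).
    have := integrableB measurableT i1 i3.
    by apply: eq_integrable => // x _ /=; rewrite EFinB.
  have i5 : mu.-integrable setT (EFin \o (fun x => (psi_dil (x + 1) * cos
    (2 * pi * (x * y)) -
       2 * (psi_dil x * cos (2 * pi * (x * y)))) + psi_dil (x + -1) * cos
         (2 * pi * (x * y)))).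
    have := integrableD measurableT i4 i2.
    by apply: eq_integrable => // x _ /=; rewrite EFinD.
  rewrite {2 3 4}/cosT -RintegralZl// -RintegralB// -RintegralD// -RintegralZl//.
  by apply: eq_Rintegral => x _; rewrite /dstep -!/(psi_dil _) addr0; ring.
have := cosT_derive (ltr0n _ 2 : 0 < 2 :> R) is_derive_step continuous_dstep
  vanishes_step vanishes_dstep y.
rewrite E !T ?normrN ?normr1// mulN1r mulrN cosN mul1r => h.
apply: (@mulfI _ (2 * pi)); first by rewrite mulf_neq0// gt_eqF.
have e : pi * (N / pi) = N by rewrite mulrC divfK// gt_eqF.
rewrite mulrA -h; transitivity (2 * (pi * (N / pi)) *
  ((cos (2 * pi * y) - 1) * cosT psi_dil y)); [rewrite e; ring|ring].
Qed.

End dilation.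

(** The indicator of (-3, 3) smoothed at scale 1/8: it is 1 on [-2, 2], outside which [step]
    vanishes, and 0 for |x| >= 4. *)
Definition plateau x : R := psi_mass^-1 * (Psi (1 * (x + 3)) + -1 * Psi (1 *
  (x + -3))).

Lemma smooth1_plateau : smooth1 plateau.
Proof.
apply: smooth1Z; apply: smooth1D; last apply: smooth1Z.
  exact/smooth1_dilation_translation/smooth1_Psi.
exact/smooth1_dilation_translation/smooth1_Psi.
Qed.

Lemma vanishes_plateau : vanishes 4 plateau.
Proof.
move=> x; rewrite real_ler_normr ?num_real// /plateau => /orP[x2|x2].
  by rewrite !Psi_right; [rewrite mulN1r subrr mulr0|lra..].
by rewrite !Psi_left; [rewrite !mulr0 addr0 mulr0|lra..].
Qed.

Lemma plateau1 x : `|x| <= 2 -> plateau x = 1.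
Proof.
rewrite ler_norml => /andP[x1 x2]; rewrite /plateau Psi_right; last by lra.
by rewrite Psi_left; [rewrite mulr0 addr0 mulVf ?gt_eqF ?psi_mass_gt0|lra].
Qed.

Lemma plateau_le1 x : `|plateau x| <= 1.
Proof.
have J0 := psi_mass_gt0; rewrite /plateau normrM gtr0_norm ?invr_gt0// mulrC
  ler_pdivrMr//.
set a := Psi _; set b := Psi _.
have := (Psi_ge0 (1 * (x + 3)), Psi_ge0 (1 * (x + -3)), (Psi_le (1 *
  (x + 3)), Psi_le (1 * (x + -3)))).
rewrite -/a -/b => -[[? ?] [? ?]].
by rewrite ler_norml; apply/andP; split; lra.
Qed.

End example_functions.

(** * The tensors F_j, their products over faces, and the resulting integrand *)

Section example_tensors.
Context {R : realType} (m0 : nat).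
Local Notation mu := (@lebesgue_measure R).
Local Notation M := (2 ^ m0)%N.
Local Notation m := m0.+1.
Local Notation top := ([ffun=> true] : cube m).

Let M0 : (0 < M)%N. Proof. by rewrite expn_gt0. Qed.

(* Among the functions with [j ord0 = true] only the one indexed by [top] carries
   [step]; the others are plateaus equal to 1 on its support. *)
Definition factor (N : R) (j : cube m) (i : 'I_m) : R -> R :=
  if i == ord0 then
    if j ord0 then (if j == top then step M N else plateau M)
    else fun t => bump (N * t)
  else bump.

Lemma vanishes_bump : vanishes 8^-1 (@bump R).
Proof. by move=> x; exact: bump_out. Qed.

Section factor.
Variable N : R.
Hypothesis N1 : 1 <= N.

Lemma smooth1_factor j i : smooth1 (factor N j i).
Proof.
rewrite /factor; case: eqP => _; last exact: smooth1_bump.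
case: (j ord0); last exact/smooth1_dilation/smooth1_bump.
by case: eqP => _; [exact: smooth1_step|exact: smooth1_plateau].
Qed.

Lemma vanishes_factor j i : vanishes 4 (factor N j i).
Proof.
have v : vanishes 4 (@bump R).
  by apply: vanishesW vanishes_bump; lra.
rewrite /factor; case: eqP => _ //.
case: (j ord0).
  case: eqP => _; last exact: vanishes_plateau.
  by apply: vanishesW (vanishes_step M0 N1); lra.
move=> x x4; apply: v; rewrite normrM ger0_norm; last (have N2 := N1; lra).
by have N2 := N1; nra.
Qed.

Lemma prod_factor_false i t :
  \prod_(j : cube m | ~~ j i) factor N j i t =
    if i == ord0 then psi_dil M N t else psi M t.
Proof.
have c : #|[pred j : cube m | ~~ j i]| = M.
  have := card_cube_face i false; rewrite subn1 /= => <-; apply: eq_card => j.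
  by rewrite !inE; case: (j i).
move: c; rewrite /factor; case: eqP => [->|_] c;
  last by rewrite prodr_const (_ : #|_| = M).
rewrite (eq_bigr (fun=> bump (N * t))); last by move=> j /negPf ->.
by rewrite prodr_const (_ : #|_| = M).
Qed.

Lemma prod_factor_true i t :
  \prod_(j : cube m | j i) factor N j i t =
    if i == ord0 then step M N t else psi M t.
Proof.
have c : #|[pred j : cube m | j i]| = M.
  have := card_cube_face i true; rewrite subn1 /= => <-; apply: eq_card => j.
  by rewrite !inE; case: (j i).
move: c; rewrite /factor; case: eqP => [->|_] c;
  last by rewrite prodr_const (_ : #|_| = M).
rewrite (bigD1 top) ?ffunE//= eqxx.
have [t2|t2] := leP `|t| 2; last by rewrite (vanishes_step M0 N1 (ltW t2)) mul0r.
rewrite big1 ?mulr1// => j /andP[-> /negPf ->].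
exact: plateau1.
Qed.

(* [tensor weight] is the imaginary part of the product of Fourier transforms. *)
Definition weight (i : 'I_m) (y : R) : R :=
  if i == ord0 then cosT (psi_dil M N) y * sinT (step M N) y
  else cosT (psi M) y * cosT (psi M) y.

Lemma psi_dil1 : psi_dil M (1 : R) = psi M.
Proof. by apply/funext => x; rewrite /psi_dil mul1r. Qed.

Let cdil := @continuous_psi_dil R M N.
Let vdil := vanishes_psi_dil M0 N1.
Let cpsi := @continuous_psi R M.
Let vpsi : vanishes 1 (@psi R M).
Proof. by apply: vanishesW (vanishes_psi M0); lra. Qed.

(** The strict increase of the radius leaves a neighbourhood of [x] on which [f] is identically
    0. *)
Lemma vanishes_derive1 (L L' : R) f : L < L' -> vanishes L f ->
  vanishes L' (derive1 f).
Proof.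
move=> LL' fL x xL; rewrite derive1E;
  have -> : 'D_1 f x = 'D_1 (cst 0 : R -> R) x.
  apply: near_eq_derive.
  apply/nbhs_normP; exists (`|x| - L) => /=; first by lra.
  by move=> y /= xy; apply: fL; have := ler_distD y x 0; rewrite !subr0; lra.
by rewrite derive_cst.
Qed.

Lemma smooth1_decay (L : R) f : 0 < L -> smooth1 f -> vanishes L f ->
  (exists C, forall y, `|cosT f y| ^+ 2 * (1 + y ^+ 2) <= C) /\
  (exists C, forall y, `|sinT f y| ^+ 2 * (1 + y ^+ 2) <= C).
Proof.
move=> L0 sf fL; have D x := smooth1_is_derive x sf.
have c' : continuous (derive1 f).
  by have /smooth1_continuous := smooth1_derive1n 1 sf;
    rewrite derive1nS derive1n0.
have L1 : 0 < L + 1 by lra.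
have fL1 : vanishes (L + 1) f by apply: vanishesW fL; lra.
have f'L1 : vanishes (L + 1) (derive1 f) by apply: vanishes_derive1 fL; lra.
split; first exact: cosT_decay L1 D c' fL1 f'L1.
exact: sinT_decay L1 D c' fL1 f'L1.
Qed.

Lemma integrable_weight i : mu.-integrable setT (EFin \o weight i).
Proof.
rewrite /weight; case: eqP => _.
  apply: integrable_square_decay.
  - exact: continuous_cosT cdil vdil.
  - exact: continuous_sinT (smooth1_continuous (smooth1_step M0 N))
      (vanishes_step M0 N1).
  - exact: (smooth1_decay ltr01 (smooth1_psi_dil M N) vdil).1.
  - exact: (smooth1_decay (ltr0n _ 2) (smooth1_step M0 N)
      (vanishes_step M0 N1)).2.
have cc := continuous_cosT cpsi vpsi.
have dd := (smooth1_decay ltr01 (smooth1_psi M) vpsi).1.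
exact: (integrable_square_decay cc cc dd dd).
Qed.

(** The functions [psi] and [psi_dil] are even, so their transforms are real and the imaginary part
    sees only the sine transform of [step]. Its sign is plus because the argument is [- y]. *)
Lemma im_ctensor_weight (eta : 'cV[R]_m) :
  complex.Im (ctensor (fun i y => ft
    (if i == ord0 then psi_dil M N else psi M) (- y) *
    ft (if i == ord0 then step M N else psi M) (- y)) eta) = tensor weight eta.
Proof.
have s0 (y : R) : sinT (psi M) y = 0.
  by rewrite -psi_dil1; exact: (sinT_psi_dil M0 (lexx 1)).
rewrite /ctensor /tensor !big_ord_recl /= /weight /=.
rewrite (eq_bigr (fun i => ((cosT (psi M) (eta (lift ord0 i) ord0) *
    cosT (psi M) (eta (lift ord0 i) ord0))%:C)%C)); last first.
  move=> i _; rewrite /ft s0 cosTN oppr0 Complex_mul !mulr0 !mul0r subr0 addr0.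
  by [].
rewrite -rmorph_prod /ft (sinT_psi_dil M0 N1) oppr0 !cosTN Complex_mul !mul0r
  subr0 addr0.
rewrite (sinTN _ (smooth1_continuous (smooth1_step M0 N))
  (vanishes_step M0 N1)) opprK.
by rewrite Complex_mul /= mulr0 add0r.
Qed.

End factor.
End example_tensors.

(** * A pointwise minorant for the integrand *)

Section lower_bound.
Context {R : realType} (m0 : nat).
Local Notation mu := (@lebesgue_measure R).
Local Notation M := (2 ^ m0)%N.
Local Notation m := m0.+1.

Let M0 : (0 < M)%N. Proof. by rewrite expn_gt0. Qed.

Local Notation J := (@psi_mass R M).

(** Measurability refers to the sigma-algebra generated by the coordinates, so the function is
    factored through the real number |x|^2. The absolute value makes the outer function continuous
    on the whole line. *)
Lemma measurable_japanese : measurable_fun setT (@japanese R m).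
Proof.
have cg : continuous (fun t : R => (Num.sqrt (1 + `|t|))^-1).
  pose s (t : R) := Num.sqrt (1 + `|t|).
  have cs : continuous s.
    move=> t; apply: (@continuous_comp _ _ _ (fun t : R => 1 + `|t|) Num.sqrt).
      by apply: continuousD; [exact: cst_continuous|exact: norm_continuous].
    exact: sqrt_continuous.
  move=> t; have t0 : s t != 0 by rewrite gt_eqF// sqrtr_gt0 ltr_pwDl.
  exact: (@continuousV _ _ s t t0 (cs t)).
rewrite (_ : @japanese R m = (fun t : R => (Num.sqrt (1 + `|t|))^-1) \o
    (fun x : 'cV[R]_m => \sum_i x i ord0 ^+ 2)); last first.
  by apply/funext => x /=; rewrite ger0_norm// sum_sqr_ge0.
apply: measurableT_comp; first exact: continuous_measurable_fun.
apply: measurable_sum => i; apply: measurable_funX.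
exact: measurable_coord_cV.
Qed.

(* Unlike the Riesz multiplier [eta_1 / |eta|] this one is smooth at the
  origin. *)
Definition riesz (c : R) (x : 'cV[R]_m) : R[i] :=
  Complex (c * (x ord0 ord0 * japanese x)) 0.

Lemma cos_periodic_le0 (k : nat) (y : R) : k%:R + 4^-1 <= y <= k%:R + 3 / 4 ->
  cos (2 * pi * y) <= 0.
Proof.
move=> /andP[y1 y2]; have p0 := pi_gt0 R.
have kE (z : R) : cos (z + 2 * pi * k%:R) = cos z.
  elim: k {y1 y2} => [|k IH]; first by rewrite mulr0 addr0.
  rewrite -[in RHS]IH -[RHS]cosD2pi -[pi *+ 2]mulr_natl.
  by congr cos; rewrite -[k.+1%:R]natr1; ring.
(* After k full periods are removed and half a turn is split off, the remaining angle lies in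
   [-pi/2, pi/2]. *)
have -> : 2 * pi * y = (2 * pi * (y - k%:R) - pi + pi) + 2 * pi * k%:R by ring.
rewrite kE cosDpi oppr_le0; apply: cos_ge0_pihalf; apply/andP; split; nra.
Qed.

Section bound.
Variables (c : R) (n : nat).
Hypotheses (c0 : 0 < c) (n0 : (0 < n)%N).
Local Notation N := (n%:R : R).

Let N1 : 1 <= N. Proof. by rewrite ler1n. Qed.
Let N0 : 0 < N. Proof. exact: lt_le_trans N1. Qed.

(* On the interval [k + 1/4, k + 3/4] the factor [1 - cos
  (2 pi y)] is at least 1. *)
Definition minorant (i : 'I_m) (y : R) : R :=
  if i == ord0 then
    c * J ^+ 2 / (4 * pi * m.+1%:R * N) *
      \sum_(k < n) k.+1%:R^-1 * \1_(`[k%:R + 4^-1, k%:R + 3 / 4]) y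
  else (J / 2) ^+ 2 * \1_(`[-1, 1]) y.

Lemma minorant_ge0 i y : 0 <= minorant i y.
Proof.
have p0 := pi_gt0 R.
rewrite /minorant; case: eqP => _; last by rewrite mulr_ge0// sqr_ge0.
rewrite mulr_ge0//; last by apply: sumr_ge0 => k _; rewrite mulr_ge0.
by rewrite !mulr_ge0 ?sqr_ge0 ?invr_ge0 ?mulr_ge0 ?(ltW c0) ?(ltW p0) ?(ltW
  (psi_mass_gt0 M0)).
Qed.

(** By [sinT_step] the right-hand side is a product of nonnegative factors, among them the square of
    the transform of [psi_dil], so a comparison is needed only where the minorant is nonzero. *)
Lemma minorant_le (eta : 'cV[R]_m) :
  tensor minorant eta <=
  - (c * (eta ord0 ord0 * japanese eta) * tensor (weight N) eta).
Proof.
have p0 := pi_gt0 R.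
have JN : 0 < J / N by rewrite divr_gt0// psi_mass_gt0.
set y := eta ord0 ord0; set u := japanese eta.
have u0 : 0 < u by exact: japanese_gt0.
pose P := \prod_(i < m0) (cosT (psi M) (eta (lift ord0 i) ord0)) ^+ 2.
have P0 : 0 <= P by apply: prodr_ge0 => i _; exact: sqr_ge0.
pose a := cosT (psi_dil M N) y.
have -> : - (c * (y * u) * tensor (weight N) eta) =
    c * u * (N / pi * (1 - cos (2 * pi * y)) * a ^+ 2) * P.
  rewrite /tensor big_ord_recl /weight /= -/y -/a.
  transitivity (- (c * u * (y * sinT (step M N) y) * a * P)); last first.
    by rewrite (sinT_step M0 N1) -/a; ring.
  rewrite /P (eq_bigr (fun i => cosT (psi M) (eta (lift ord0 i) ord0) ^+ 2));
    last first.
    by move=> i _; rewrite expr2.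
  by ring.
have nonneg : 0 <= c * u * (N / pi * (1 - cos (2 * pi * y)) * a ^+ 2) * P.
  apply: mulr_ge0 => //; apply: mulr_ge0; first by rewrite mulr_ge0// ltW.
  apply: mulr_ge0; last exact: sqr_ge0.
  by rewrite mulr_ge0 ?divr_ge0 ?(ltW p0) ?(ltW N0)// subr_ge0 cos_le1.
(* The minorant is supported on boxes: the first coordinate in one of the intervals, the others in
   [-1, 1]. Off the boxes it is 0 and [nonneg] suffices. *)
have [box|] := pselect (exists k : 'I_n, k%:R + 4^-1 <= y <= k%:R + 3 / 4 /\
    forall i : 'I_m0, `|eta (lift ord0 i) ord0| <= 1); last first.
  move=> nbox; rewrite [leLHS](_ : _ = 0)//.
  have [out|] := pselect (exists i : 'I_m0, ~ `|eta (lift ord0 i) ord0| <= 1).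
    have [i ei] := out; rewrite /tensor (bigD1 (lift ord0 i))//= /minorant /=.
    rewrite indicE memNset ?mulr0 ?mul0r//= in_itv/= -ler_norml; exact: ei.
  move=> /forallNP inn; rewrite /tensor big_ord_recl /minorant /= big1 ?mulr0
    ?mul0r// => k _.
  rewrite indicE memNset ?mulr0//= in_itv/= => yk; apply: nbox; exists k;
    split => // i.
  by have /contrapT := inn i.
have {box}[k [yk box]] := box.
have k0 : 0 <= k%:R :> R by rewrite ler0n.
have kn : k%:R + 1 <= N by rewrite natr1 ler_nat.
rewrite /tensor big_ord_recl; apply: ler_pM.
- exact: minorant_ge0.
- by apply: prodr_ge0 => i _; exact: minorant_ge0.
(* The intervals are disjoint, so only the [k]-th term of the sum survives at [y]. *)
- rewrite /minorant eqxx -/y (bigD1 k)//= big1 => [|l lk]; last first.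
    rewrite indicE memNset ?mulr0//= in_itv/= => /andP[l1 l2].
    move/andP: yk => [k1 k2]; move/negP: lk; apply; apply/eqP/val_inj/eqP.
    by rewrite eqn_leq; apply/andP; split; rewrite -ltnS -(ltr_nat R) -natr1; lra.
  rewrite addr0 indicE mem_set//= mulr1.
  have ya : `|y| <= N by move/andP: yk => [k1 k2]; rewrite ler_norml;
    apply/andP; split; lra.
  have a2 : (J / N / 2) ^+ 2 <= a ^+ 2.
    have ap : 0 <= J / N / 2 by rewrite divr_ge0 ?(ltW JN).
    have h := cosT_psi_dil_ge M0 N1 ya.
    by rewrite lerXn2r ?nnegrE// (le_trans ap).
  (* On the box every coordinate is at most k + 1 in absolute value, and 1 + m (k + 1)^2 <= ((m + 1)
     (k + 1))^2. *)
  have uk : (m.+1%:R * k.+1%:R)^-1 <= u.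
    have pos : 0 < m.+1%:R * k.+1%:R :> R by rewrite mulr_gt0 ?ltr0n.
    have h0 := ltW pos.
    rewrite /u /japanese lef_pV2 ?posrE//; last first.
      by rewrite sqrtr_gt0 ltr_pwDl ?sum_sqr_ge0.
    rewrite -[leRHS](ger0_norm h0) -sqrtr_sqr ler_wsqrtr//.
    have k1 : 1 <= k.+1%:R :> R by rewrite ler1n.
    have : \sum_i eta i ord0 ^+ 2 <= \sum_(i < m) k.+1%:R ^+ 2.
      apply: ler_sum => i _; rewrite -[leLHS]ger0_norm ?sqr_ge0// normrX
        lerXn2r ?nnegrE//.
      case: (unliftP ord0 i) => [i' ->|->]; first exact: le_trans (box i') k1.
      by move/andP: yk => [k2 k3]; rewrite -/y -natr1 ler_norml; apply/andP;
        split; lra.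
    rewrite sumr_const card_ord -mulr_natl => h.
    have m1 : 1 <= m%:R :> R by rewrite ler1n.
    by rewrite -[m.+1%:R]natr1; nra.
  have ck := cos_periodic_le0 yk.
  have -> : c * J ^+ 2 / (4 * pi * m.+1%:R * N) / k.+1%:R =
      c * (m.+1%:R * k.+1%:R)^-1 * (N / pi * 1 * (J / N / 2) ^+ 2).
    have fe (c' J' N' p d b : R) : N' != 0 -> p != 0 -> d != 0 -> b != 0 ->
        c' * J' ^+ 2 / (4 * p * d * N') / b = c' * (d * b)^-1 * (N' / p * 1 *
          (J' / N' / 2) ^+ 2).
      by move=> *; field; do ?[apply/andP; split].
    by apply: fe; rewrite gt_eqF// ltr0n.
  apply: ler_pM => //.
  + by rewrite mulr_ge0 ?invr_ge0 ?mulr_ge0// ltW.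
  + by apply: mulr_ge0; [rewrite mulr1 divr_ge0 ?(ltW p0) ?(ltW N0)|exact:
      sqr_ge0].
  + by rewrite ler_pM2l.
  + apply: ler_pM => //; rewrite ?sqr_ge0//.
      by rewrite !mulr_ge0 ?invr_ge0// ltW.
    by rewrite ler_pM2l ?divr_gt0//; lra.
- apply: ler_prod => i _; rewrite minorant_ge0 /= /minorant /=.
  rewrite indicE mem_set ?mulr1; last by rewrite /= in_itv/= -ler_norml.
  have J0 : 0 <= J / 2 by rewrite divr_ge0// ltW// psi_mass_gt0.
  have h := @cosT_psi_dil_ge R M M0 1 (lexx 1) (eta (lift ord0 i) ord0) (box i).
  rewrite psi_dil1 divr1 in h.
  by rewrite lerXn2r ?nnegrE// (le_trans J0).
Qed.

End bound.
End lower_bound.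

(** * The lower bound for the form by a harmonic sum *)

Section lower_bound_integral.
Context {R : realType} (m0 : nat).
Local Notation mu := (@lebesgue_measure R).
Local Notation M := (2 ^ m0)%N.
Local Notation m := m0.+1.

Let M0 : (0 < M)%N. Proof. by rewrite expn_gt0. Qed.

Local Notation J := (@psi_mass R M).

Variables (c : R) (n : nat).
Hypotheses (c0 : 0 < c) (n0 : (0 < n)%N).
Local Notation N := (n%:R : R).

Let N1 : 1 <= N. Proof. by rewrite ler1n. Qed.

Lemma integral_indic_cc (a b : R) : a <= b ->
  mu.-integrable setT (EFin \o \1_(`[a, b])) /\ \int[mu]_x \1_(`[a, b]) x = b - a.
Proof.
move=> ab; split; first exact: integrable_indic_itv.
rewrite /Rintegral integral_indic//= setIT lebesgue_measure_itv /= lte_fin.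
by case: ltgtP ab => // ->; rewrite subrr.
Qed.

Lemma integral_sum_real (I : Type) (s : seq I) (h : I -> R -> R) :
  (forall i, mu.-integrable setT (EFin \o h i)) ->
  mu.-integrable setT (EFin \o (fun x => \sum_(i <- s) h i x)) /\
  \int[mu]_x (\sum_(i <- s) h i x) = \sum_(i <- s) \int[mu]_x h i x.
Proof.
move=> ih; elim: s => [|i s [IHi IHe]].
  split; first by under eq_fun do rewrite big_nil; exact: integrable0.
  by under eq_Rintegral do rewrite big_nil; rewrite big_nil /Rintegral integral0.
split.
  have := integrableD measurableT (ih i) IHi.
  by apply: eq_integrable => // x _ /=; rewrite big_cons EFinD.
under eq_Rintegral do rewrite big_cons.
by rewrite RintegralD// IHe big_cons.
Qed.

Lemma integral_scale (k : R) (h : R -> R) : mu.-integrable setT (EFin \o h) ->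
  mu.-integrable setT (EFin \o (fun x => k * h x)) /\
  \int[mu]_x (k * h x) = k * \int[mu]_x h x.
Proof.
move=> ih; split; last by rewrite RintegralZl.
have := integrableZl measurableT k ih.
by apply: eq_integrable => // x _ /=; rewrite EFinM.
Qed.

(** Each interval has length 1/2, so the weights 1/(k + 1) add up to half of a harmonic sum; the 2
    in the other case is the length of [-1, 1]. *)
Lemma integral_minorant (i : 'I_m) :
  mu.-integrable setT (EFin \o minorant c n i) /\
  \int[mu]_y minorant c n i y =
    if i == ord0 then
      c * J ^+ 2 / (4 * pi * m.+1%:R * N) * (2^-1 * series harmonic n)
    else (J / 2) ^+ 2 * 2.
Proof.
rewrite /minorant; case: eqP => _.
  have h (k : 'I_n) : mu.-integrable setT (EFin \o
       (fun y : R => k.+1%:R^-1 * \1_(`[k%:R + 4^-1, k%:R + 3 / 4]) y)) /\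
       \int[mu]_y (k.+1%:R^-1 * \1_(`[k%:R + 4^-1, k%:R + 3 / 4]) y) =
         k.+1%:R^-1 * 2^-1.
    have le : k%:R + 4^-1 <= k%:R + 3 / 4 :> R by lra.
    have [i1 e1] := integral_indic_cc le.
    have [i2 ->] := integral_scale (k.+1%:R^-1) i1; split => //.
    by rewrite e1; congr (_ * _); lra.
  have [i1 e1] := integral_sum_real (index_enum 'I_n) (fun k => (h k).1).
  have [i2 ->] := integral_scale (c * J ^+ 2 / (4 * pi * m.+1%:R * N)) i1.
  split => //; rewrite e1; congr (_ * _).
  rewrite (eq_bigr (fun k : 'I_n => k.+1%:R^-1 * 2^-1)); last by move=> k _;
    exact: (h k).2.
  by rewrite -mulr_suml mulrC /series /= big_mkord.
have [i1 e1] := @integral_indic_cc (-1) 1 (ltac:(lra)).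
have [i2 ->] := integral_scale ((J / 2) ^+ 2) i1; split => //.
by rewrite e1; congr (_ * _); lra.
Qed.

Lemma im_le_normc (a b : R) : `|b| <= Normc.normc (Complex a b).
Proof. by rewrite /= -sqrtr_sqr ler_wsqrtr// lerDr sqr_ge0. Qed.

Lemma continuous_factor_false (i : 'I_m) :
  continuous (fun t => \prod_(j : cube m | ~~ j i) factor N j i t).
Proof.
rewrite (_ : (fun t => _) = if i == ord0 then psi_dil M N else psi M); last first.
  by apply/funext => t; rewrite prod_factor_false//; case: eqP.
by case: eqP => _; [exact: continuous_psi_dil|exact: continuous_psi].
Qed.

Lemma continuous_factor_true (i : 'I_m) :
  continuous (fun t => \prod_(j : cube m | j i) factor N j i t).
Proof.
rewrite (_ : (fun t => _) = if i == ord0 then step M N else psi M); last first.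
  by apply/funext => t; rewrite prod_factor_true//; case: eqP.
case: eqP => _; last exact: continuous_psi.
exact: smooth1_continuous (smooth1_step M0 N).
Qed.

Lemma vanishes_prod_factor (P : cube m -> bool) (i : 'I_m) j : P j ->
  vanishes 4 (fun t => \prod_(j : cube m | P j) factor N j i t).
Proof.
move=> Pj t t4; rewrite (bigD1 j)//= (vanishes_factor N1)//.
by rewrite mul0r.
Qed.

(** The modulus is bounded below by the imaginary part, and that by the integral of the minorant.
    The 8 is 4 times 2 from the half-length intervals, and [J ^+ 2 / 2] is [(J / 2) ^+ 2] times
    2. *)
Lemma pv_integral_factor_ge :
  c * J ^+ 2 / (8 * pi * m.+1%:R * N) * series harmonic n * (J ^+ 2 / 2) ^+ m0 <=
  Normc.normc (pv_integral (twin_mx m) (riesz c)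
    (fun x => \prod_(j : cube m) tensor (factor N j) (coord_proj R j *m x))).
Proof.
rewrite (@pv_integral_tensor R 4); last 4 first.
- exact: continuous_factor_false.
- exact: continuous_factor_true.
- by move=> i; apply: (@vanishes_prod_factor _ i [ffun=> false]); rewrite ffunE.
- by move=> i; apply: (@vanishes_prod_factor _ i [ffun=> true]); rewrite ffunE.
set G := (fun eta => _).
have imG : im_part G = fun eta => c * (eta ord0 ord0 * japanese eta) * tensor
  (weight N) eta.
  apply/funext => eta; rewrite -(im_ctensor_weight N1) /im_part /G.
  have -> : (fun (i : 'I_m) (y : R) =>
     ft (fun t => \prod_(j : cube m | ~~ j i) factor N j i t) (- y) *
     ft (fun t => \prod_(j : cube m | j i) factor N j i t) (- y)) =
     (fun i y => ft (if i == ord0 then psi_dil M N else psi M) (- y) *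
    ft (if i == ord0 then step M N else psi M) (- y)).
    apply/funext => i; apply/funext => y; congr (ft _ _ * ft _ _).
      by apply/funext => t; rewrite prod_factor_false//; case: eqP.
    by apply/funext => t; rewrite prod_factor_true//; case: eqP.
  by case: (ctensor _ eta) => a b; rewrite /riesz Complex_mul /= mulr0 add0r
    mulrC.
have [iw _] := integral_tensor (@integrable_weight R m0 N N1).
(* The multiplier is bounded by [c], so [tensor (weight N)] times [c] dominates. *)
have iG : (lebesgue_cV m).-integrable setT (EFin \o im_part G).
  apply: (le_integrable measurableT (g :=
    fun eta => (c%:E * (tensor (weight N) eta)%:E)%E)).
  - apply/(measurable_EFinP _ _); rewrite imG; apply: measurable_funM.
      apply: measurable_funM => //; apply: measurable_funM.
        exact: measurable_coord_cV.
      exact: measurable_japanese.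
    by apply/(measurable_EFinP _ _); case/integrableP: iw.
  - move=> eta _; rewrite /= imG lee_fin !normrM -mulrA ler_wpM2l// -[leRHS]mul1r.
    by rewrite ler_wpM2r// -normrM coord_japanese_le1.
  - exact: integrableZl.
have [il el] := integral_tensor (fun i => (integral_minorant i).1).
apply: le_trans (im_le_normc _ _).

(* The imaginary part of the integrand is nonpositive, so it is its opposite that lies above the
   minorant. *)
rewrite -normrN; apply: le_trans (ler_norm _).
rewrite -mulN1r -RintegralZl//.
have -> : c * J ^+ 2 / (8 * pi * m.+1%:R * N) * series harmonic n *
  (J ^+ 2 / 2) ^+ m0 =
    \int[lebesgue_cV m]_eta tensor (minorant c n) eta.
  rewrite el big_ord_recl (integral_minorant ord0).2 eqxx.
  rewrite (eq_bigr (fun=> (J / 2) ^+ 2 * 2)); last first.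
    by move=> i _; rewrite (integral_minorant _).2.
  rewrite prodr_const card_ord; congr (_ * _ ^+ _).
    set h := series harmonic n.
    have fe (c' J' N' p d b : R) : N' != 0 -> p != 0 -> d != 0 ->
        c' * J' ^+ 2 / (8 * p * d * N') * b = c' * J' ^+ 2 /
          (4 * p * d * N') * (2^-1 * b).
      by move=> *; field; do ?[apply/andP; split].
    by apply: fe; rewrite gt_eqF// ?ltr0n// pi_gt0.
  by rewrite exprMn; field.
apply: le_Rintegral => //.
  have := integrableZl measurableT (-1) iG.
  by apply: eq_integrable => // x _ /=; rewrite EFinM.
by move=> eta _; rewrite mulN1r imG; exact: minorant_le.
Qed.

End lower_bound_integral.

(** * The product of the norms *)

Section norms.
Context {R : realType} (m0 : nat).
Local Notation mu := (@lebesgue_measure R).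
Local Notation M := (2 ^ m0)%N.
Local Notation m := m0.+1.

Let M0 : (0 < M)%N. Proof. by rewrite expn_gt0. Qed.

Local Notation J := (@psi_mass R M).

Section dilated.
Variable N : R.
Hypothesis N1 : 1 <= N.

Let N0 : 0 < N. Proof. exact: lt_le_trans N1. Qed.

(** The M-th power turns each bump into [psi], or [psi_dil] in the first variable, so the integral
    inside the norm is a product of masses. *)
Lemma Lpnorm_factor (j : cube m) : ~~ j ord0 ->
  Lpnorm (M%:R)%:E (tensor (factor N j)) = ((J / N * J ^+ m0) `^ (M%:R^-1))%:E.
Proof.
move=> j0; rewrite /Lpnorm unlock -poweR_EFin; congr (_ `^ _)%E.
pose h (i : 'I_m) : R -> R := if i == ord0 then psi_dil M N else psi M.
have ih i : mu.-integrable setT (EFin \o h i).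
  rewrite /h; case: eqP => _.
    exact: integrable_vanishes (@continuous_psi_dil R M N)
      (vanishes_psi_dil M0 N1).
  exact: integrable_vanishes (@continuous_psi R M) (vanishes_psi M0).
have [i1 e1] := integral_tensor ih.
have -> : (\int[lebesgue_cV m]_x `|(EFin \o tensor (factor N j)) x| `^ M%:R)%E =
    (\int[lebesgue_cV m]_x (tensor h x)%:E)%E.
  apply: eq_integral => x _ /=; rewrite powR_mulrn//; congr EFin.
  have t0 : 0 <= tensor (factor N j) x.
    apply: prodr_ge0 => i _; rewrite /factor (negPf j0).
    by case: eqP => _; exact: bump_ge0.
  rewrite ger0_norm// /tensor -prodrXl; apply: eq_bigr => i _.
  by rewrite /factor /h (negPf j0); case: eqP.
rewrite -[LHS]fineK; last exact: integrable_fin_num.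
congr EFin; rewrite -[LHS]/(\int[lebesgue_cV m]_x tensor h x) e1 big_ord_recl.
rewrite {1}/h eqxx (integral_psi_dil M0 N1); congr (_ * _).
by rewrite (eq_bigr (fun=> J)) ?prodr_const ?card_ord.
Qed.

(** [4 * J + 1] exceeds both the bound 4J for [step] and the bound 1 for [plateau]; the remaining
    factors are bumps, at most 1. The bound is uniform in N. *)
Lemma Lpnorm_factor_oo (j : cube m) : j ord0 ->
  (Lpnorm +oo (tensor (factor N j)) <= (4 * J + 1)%:E)%E.
Proof.
have J0 := psi_mass_gt0 M0 : 0 < J.
(* The norm for p = oo is an essential supremum or, if the whole space has measure 0, the default
   value 0. *)
move=> j0; rewrite /Lpnorm unlock; case: ifP => _; last by rewrite lee_fin; lra.
apply/ess_supP; apply: aeW => x /=; rewrite lee_fin /tensor big_ord_recl normrM.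
rewrite -[leRHS]mulr1; apply: ler_pM => //.
  rewrite /factor /= j0; case: eqP => _;
    first by have := step_le M0 N (x ord0 ord0); lra.
  by have := plateau_le1 M0 (x ord0 ord0); lra.
rewrite normr_prod; apply: prodr_ile1 => i _; rewrite normr_ge0 /= /factor /=.
by rewrite ger0_norm ?bump_ge0 ?bump_le1.
Qed.

Definition half_exponent (j : cube m) : \bar R :=
  if j ord0 then +oo%E else (M%:R)%:E.

Lemma prod_le_const (P : pred (cube m)) (f : cube m -> \bar R) (D : R) :
  (forall j, P j -> 0 <= f j)%E -> (forall j, P j -> f j <= D%:E)%E ->
  (\prod_(j | P j) f j <= (D ^+ #|P|)%:E)%E.
Proof.
move=> f0 fD.
rewrite -prodr_const.
have : (0 <= \prod_(j | P j) f j <= (\prod_(j | P j) D)%:E)%E.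
  elim/big_rec2: _ => [|j x y Pj /andP[y0 xy]];
    first by rewrite lexx lee_fin ler01.
  by rewrite mule_ge0 ?f0//= EFinM lee_pmul ?f0 ?fD.
by case/andP.
Qed.

(** Both faces have M elements: one gives M bounded factors, while on the other M equal roots of
    order M recombine to the L^1 norm, which carries the factor 1/N. *)
Lemma prod_Lpnorm_le :
  (\prod_(j : cube m) Lpnorm (half_exponent j) (tensor (factor N j)) <=
   ((4 * J + 1) ^+ M * (J / N * J ^+ m0))%:E)%E.
Proof.
have J0 := psi_mass_gt0 M0 : 0 < J.
have X0 : 0 <= J / N * J ^+ m0 by rewrite mulr_ge0 ?exprn_ge0 ?divr_ge0 ?(ltW
  J0) ?(ltW N0).
have c b : #|[pred j : cube m | j ord0 == b]| = M.
  by have := @card_cube_face m ord0 b; rewrite subn1.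
have ct : #|(fun j : cube m => j ord0)| = M.
  by rewrite -[RHS](c true); apply: eq_card => j; rewrite /in_mem /=;
    case: (j ord0).
have cf : #|(fun j : cube m => ~~ j ord0)| = M.
  by rewrite -[RHS](c false); apply: eq_card => j; rewrite /in_mem /=;
    case: (j ord0).
rewrite (bigID (fun j : cube m => j ord0)) /= EFinM; apply: lee_pmul.
- by apply: prode_ge0 => j _; exact: Lnorm_ge0.
- by apply: prode_ge0 => j _; exact: Lnorm_ge0.
- rewrite -[X in (_ ^+ X)%R]ct; apply: prod_le_const => j j0;
    first exact: Lnorm_ge0.
  by rewrite /half_exponent j0; exact: Lpnorm_factor_oo.
- move: X0; set X := J / N * J ^+ m0 => X0.
  have e : (X `^ (M%:R^-1)) ^+ M = X.
    by rewrite -powR_mulrn ?powR_ge0// -powRrM mulVf ?pnatr_eq0 -?lt0n// powRr1.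
  have := @prod_le_const (fun j => ~~ j ord0)
    (fun j => Lpnorm (half_exponent j) (tensor (factor N j))) (X `^ (M%:R^-1)).
  rewrite cf e; apply.
    by move=> j _; exact: Lnorm_ge0.
  by move=> j j0; rewrite /half_exponent (negPf j0) Lpnorm_factor.
Qed.

End dilated.

Lemma half_exponent_gt (q : R) j : q < 2 ^+ m0 -> (q%:E < half_exponent j)%E.
Proof.
by move=> qM; rewrite /half_exponent; case: (j ord0);
  rewrite ?ltry// lte_fin natrX.
Qed.

(** In the extended reals the inverse of +oo is 0, so only the M terms 1/M on one face
    contribute. *)
Lemma sum_half_exponentV : (\sum_(j : cube m) (half_exponent j)^-1 = 1)%E.
Proof.
have cf : #|(fun j : cube m => ~~ j ord0)| = M.
  have := @card_cube_face m ord0 false; rewrite subn1 => <-.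
  by apply: eq_card => j; rewrite /in_mem /=; case: (j ord0).
rewrite (bigID (fun j : cube m => j ord0)) /= big1 ?add0e; last first.
  by move=> j j0; rewrite /half_exponent j0 invey.
rewrite (eq_bigr (fun=> (M%:R^-1 : R)%:E)); last first.
  by move=> j /negPf j0; rewrite /half_exponent j0 inver pnatr_eq0 gtn_eqF.
rewrite sumEFin sumr_const (_ : #|_| = M)//.
by rewrite -[_^-1 *+ _]mulr_natr mulVf// pnatr_eq0 gtn_eqF.
Qed.

End norms.

(** * Divergence of the harmonic series and the contradiction *)

Lemma harmonic_unbounded (R : realType) (K : R) :
  exists2 n : nat, (0 < n)%N & K < series harmonic n.
Proof.
apply: contrapT => h; apply: (@dvg_harmonic R).
apply: nondecreasing_is_cvgn.
  by apply: nondecreasing_series => n _ _; exact: harmonic_ge0.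
(* The value 0 accounts for the empty sum at n = 0, which the negated statement does not cover. *)
exists (Num.max K 0) => _ [n _ <-]; rewrite le_max.
case: n => [|n]; first by rewrite /series /= big_geq// lexx orbT.
apply/orP; left; rewrite leNgt; apply/negP => Kn; apply: h.
by exists n.+1.
Qed.

Theorem theorem1p5 (R : realType) (m : nat) (q : R)
    (hm : (2 <= m)%N) (hq0 : 0 <= q) (hq : q < 2 ^+ (m - 1)) :
  ~ (forall (Delta : R) (p : cube m -> \bar R),
       1 < Delta ->
       (forall j, (q%:E < p j)%E) ->
       (\sum_(j : cube m) (p j)^-1 = 1)%E ->
       exists C : R,
       forall Pi : 'M[R]_(m, m + m),
         (forall j : cube m, Delta_regular Delta (coord_proj R j *m Pi^T)) ->
       forall Khat : 'cV[R]_m -> R[i],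
         cz_multiplier (2 ^ (6 * m)) Khat ->
       forall F : cube m -> 'cV[R]_m -> R,
         (forall j, smooth (F j)) ->
         (forall j, compactly_supported (F j)) ->
         ((Normc.normc (pv_integral Pi Khat
            (fun x => \prod_(j : cube m) F j (coord_proj R j *m x))%R))%:E
          <= C%:E * \prod_(j : cube m) Lpnorm (p j) (F j))%E).
Proof.
case: m hm hq => [//|m0] _ hq bounded; rewrite subn1 in hq.
(* [C] is fixed before [n]: the exponents, the matrix and the multiplier are the same for all [n].
   Any Delta above 1 would serve, since all the matrices involved are the identity. *)
have [C HC] := bounded 2 (@half_exponent R m0) (ltr1n _ 2)
  (fun j => half_exponent_gt j hq) (sum_half_exponentV _).
have M0 : (0 < 2 ^ m0)%N by rewrite expn_gt0.
have J0 := @psi_mass_gt0 R _ M0.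
have p0 := pi_gt0 R.
set j := @psi_mass R (2 ^ m0) in J0.
have sf : symb 0 (fun x : 'cV[R]_m0.+1 => x ord0 ord0 * japanese x)
  by exact: symb_coord.
have [c c0 cz] := cz_multiplier_symb (2 ^ (6 * m0.+1)) sf.
(* [a] and [b] are the constants of the lower and upper bounds with their common factor 1/n removed,
   so neither depends on [n]. The absolute value in [b] allows for a negative [C]. *)
pose a := c * j ^+ 2 / (8 * pi * m0.+2%:R) * (j ^+ 2 / 2) ^+ m0.
have a0 : 0 < a.
  by rewrite !mulr_gt0 ?invr_gt0 ?mulr_gt0 ?exprn_gt0 ?mulr_gt0 ?ltr0n.
pose b := `|C| * ((4 * j + 1) ^+ (2 ^ m0) * (j * j ^+ m0)).
(* The two bounds together give a/n times the harmonic sum <= b/n, which fails for this [n]. *)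
have [n n0 nb] := harmonic_unbounded (b / a).
have N1 : 1 <= n%:R :> R by rewrite ler1n.
have N0 : 0 < n%:R :> R by exact: lt_le_trans N1.
have := HC (twin_mx m0.+1) _ (riesz c) cz (fun j => tensor (factor n%:R j)).
have reg (i : cube m0.+1) : Delta_regular 2 (coord_proj R i *m (twin_mx m0.+1)^T).
  by rewrite coord_proj_twin_mx; apply: Delta_regular1; rewrite ltr1n.
move=> /(_ reg (fun i => smooth_tensor (smooth1_factor n%:R i))
  (fun i => compactly_supported_tensor (vanishes_factor N1 i))) le.
have ge := @pv_integral_factor_ge R m0 c n c0 n0.
have up := @prod_Lpnorm_le R m0 n%:R N1.
have : a / n%:R * series harmonic n <= b / n%:R.
  have -> : a / n%:R * series harmonic n =
      c * j ^+ 2 / (8 * pi * m0.+2%:R * n%:R) * series harmonic n *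
        (j ^+ 2 / 2) ^+ m0.
    by rewrite /a [in RHS]invfM; ring.
  apply: le_trans ge _; rewrite -lee_fin; apply: le_trans le _.
  have -> : b / n%:R = `|C| * ((4 * j + 1) ^+ (2 ^ m0) * (j / n%:R * j ^+ m0)).
    by rewrite /b; ring.
  have P0 : (0 <= \prod_i Lpnorm (half_exponent i) (tensor (factor (n%:R : R)
    (i : cube m0.+1))))%E.
    by apply: prode_ge0 => i _; exact: Lnorm_ge0.
  rewrite EFinM; apply: le_trans (lee_wpmul2l _ up); last by rewrite lee_fin.
  by apply: lee_wpmul2r => //; rewrite lee_fin ler_norm.
by rewrite mulrAC ler_pM2r ?invr_gt0// leNgt -ltr_pdivrMl// mulrC nb.
Qed.
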